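(* Let $p\in(1,\infty)$, $\frac1p+\frac1{p'}=1$, and let $W$ be a Banach space with $X\subseteq W\subseteq X_{-1}$ such that $A_W$ has maximal $L^p$-regularity. Let $C:Z\to Y$ and $B:U\to W$ be bounded, where $Z$ denotes $\mathcal D(A_W)$ equipped with the graph norm. Then $\mathcal F^\alpha$ is bounded $L^p_\alpha(\mathbb R_+,U)\to L^p_\alpha(\mathbb R_+,Y)$ for any $\alpha\in(-\frac1p,\frac1{p'})$.
   Context: $X,U,Y$ are Banach spaces and $A$ is a densely defined sectorial operator of type $<\pi/2$ with dense range on $X$, so that $-A$ generates a bounded analytic semigroup $T(\cdot)$ on $X$. (Sectorial of type $\omega$: $A$ closed, $\sigma(A)\subseteq\overline{S(\omega)}$ with $S(\omega)=\{z\ne0:|\arg z|<\omega\}$ for $\omega\in(0,\pi)$ and $S(0)=(0,\infty)$, and $\sup\{\|\lambda R(\lambda,A)\|:|\arg\lambda|\ge\nu\}<\infty$ for each $\nu\in(\omega,\pi)$.) $X_{-1}$ is the completion of $X$ for $\|(\mathrm{Id}+A)^{-1}\cdot\|_X$; $T(\cdot)$ extends to a strongly continuous semigroup $T_{-1}(\cdot)$ on $X_{-1}$ with generator $-A_{-1}$, $A_{-1}$ extending $A$. Inclusions of Banach spaces are continuous. $A_W$ is the restriction (part) of $A_{-1}$ to $W$, i.e. $\mathcal D(A_W)=\{w\in W\cap\mathcal D(A_{-1}):A_{-1}w\in W\}$, assumed to be sectorial in $W$, with $-A_W$ generating the restriction of the semigroup to $W$ (again written $T(\cdot)$). Maximal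 $L^p$-regularity of $A_W$ means that the convolution $f\mapsto T(\cdot)*f$, $(T(\cdot)*f)(t)=\int_0^tT(t-s)f(s)\,ds$, is bounded $L^p(\mathbb R_+,W)\to L^p(\mathbb R_+,Z)$, where $\mathbb R_+=(0,\infty)$. $L^p_\alpha(\mathbb R_+,E)=\{f:\ t\mapsto t^\alpha f(t)\in L^p(\mathbb R_+,E)\}$ with norm $\|t^\alpha f\|_{L^p}$. $\mathcal F^\alpha$ is the input-output operator $\mathcal F^\alpha u=CT(\cdot)B*u$, i.e. $C$ applied to $t\mapsto\int_0^tT(t-s)Bu(s)\,ds$, considered on $L^p_\alpha(\mathbb R_+,U)$. *)

(* Defs.v *)
From HB Require Import structures.
From mathcomp Require Import all_boot all_order all_algebra.
From mathcomp Require Import complex.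
From mathcomp Require Import all_classical all_reals all_analysis.
Set Implicit Arguments.
Unset Strict Implicit.
Unset Printing Implicit Defensive.
Import Order.TTheory GRing.Theory Num.Theory.
Import numFieldNormedType.Exports.
Local Open Scope classical_set_scope.
Local Open Scope ring_scope.

(* Banach spaces are complex: [completeNormedModType R[i]].  Their norm [`|x|]
   is a nonnegative element of [R[i]]; [rnorm x] is the same number in [R]. *)
Definition rnorm (R : realType) (E : normedModType R[i]) (x : E) : R :=
  complex.Re `|x|.

Section Bochner.
Variables (R : realType) (E : normedModType R[i]).
Notation mu := (@lebesgue_measure R).
Implicit Types (D : set R) (f s : R -> E).

Definition simple_fun s : Prop :=
  finite_set (range s) /\ forall x, measurable (s @^-1` [set x]).

Definition integrable_simple D s : Prop :=
  simple_fun s /\ forall x, x != 0 -> (mu (D `&` s @^-1` [set x]) < +oo)%E.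

(* For x = 0 the measure may be infinite; the term is then 0 anyway. *)
Definition simple_integral D s : E :=
  \sum_(x \in range s) ((fine (mu (D `&` s @^-1` [set x])))%:C)%C *: x.

Definition strongly_measurable D f : Prop :=
  exists s : nat -> R -> E, (forall n, simple_fun (s n)) /\
    {ae mu, forall t, D t -> s n t @[n --> \oo] --> f t}.

Definition is_bochner_integral D f (v : E) : Prop :=
  strongly_measurable D f /\
  exists s : nat -> R -> E,
    [/\ forall n, integrable_simple D (s n),
        (\int[mu]_(t in D) (rnorm (f t - s n t))%:E)%E @[n --> \oo] --> 0%E
      & simple_integral D (s n) @[n --> \oo] --> v].

Definition Lp_norm (p : R) f : \bar R :=
  ((\int[mu]_(t in `]0%R, +oo[) (rnorm (f t) `^ p)%:E) `^ p^-1)%E.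

Definition in_Lp (p : R) f : Prop :=
  strongly_measurable `]0, +oo[ f /\ (Lp_norm p f < +oo)%E.

Definition weight (a : R) f : R -> E := fun t => ((t `^ a)%:C)%C *: f t.

Definition Lpw_norm (p a : R) f : \bar R := Lp_norm p (weight a f).

Definition in_Lpw (p a : R) f : Prop := in_Lp p (weight a f).

End Bochner.

Section Operators.
Variables (R : realType) (E : normedModType R[i]).
Implicit Types (A : set (E * E)) (T : R -> {linear E -> E}).

(* Unbounded operators are represented by their graphs. *)
Definition operator A : Prop :=
  [/\ A (0, 0),
      forall (a : R[i]) u v, A u -> A v -> A (a *: u.1 + v.1, a *: u.2 + v.2)
    & forall y, A (0, y) -> y = 0].

Definition op_dom A : set E := [set x | exists y, A (x, y)].
Definition op_range A : set E := [set y | exists x, A (x, y)].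
Definition op_opp A : set (E * E) := [set xy | A (xy.1, - xy.2)].

(* [S] is the bounded two-sided inverse R(l, A) of l - A : D(A) -> E. *)
Definition is_resolvent A (l : R[i]) (S : {linear E -> E}) : Prop :=
  continuous S /\ forall x y, S y = x <-> A (x, l *: x - y).

Definition spectrum A : set R[i] :=
  [set l | ~ exists S : {linear E -> E}, is_resolvent A l S].

Definition polar (r theta : R) : R[i] := Complex (r * cos theta) (r * sin theta).

Definition sector (w : R) : set R[i] :=
  [set z | exists r theta, [/\ 0 < r,
     (if w == 0 then theta = 0 else `|theta| < w) & z = polar r theta]].

(* The set of all l with nu <= |arg l|, for arg valued in (-pi, pi]. *)
Definition arg_ge (nu : R) : set R[i] :=
  [set z | exists r theta,
     [/\ 0 < r, nu <= `|theta|, `|theta| <= pi & z = polar r theta]].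

Definition sectorial (w : R) A : Prop :=
  [/\ 0 <= w < pi, operator A, closed A, spectrum A `<=` closure (sector w : set R[i]^o)
    & forall nu, w < nu < pi -> exists M : R,
        forall l (S : {linear E -> E}), arg_ge nu l -> is_resolvent A l S ->
        forall x, rnorm (l *: S x) <= M * rnorm x].

(* Only the values [T t] with [0 <= t] are relevant. *)
Definition semigroup T : Prop :=
  [/\ forall t, 0 <= t -> continuous (T t),
      forall x, T 0 x = x
    & forall s t x, 0 <= s -> 0 <= t -> T (s + t) x = T s (T t x)].

Definition C0_semigroup T : Prop :=
  semigroup T /\ forall x, T t x @[t --> 0^'+] --> x.

Definition generator T : set (E * E) :=
  [set xy | ((h^-1)%:C)%C *: (T h xy.1 - xy.1) @[h --> 0^'+] --> xy.2].

(* [G] generates the semigroup [T], which is strongly continuous on (0, oo) and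
   bounded near 0, in the sense that R(l, G) is the Laplace transform of [T] at
   every large real l.  If [T] is strongly continuous at 0, this says that [G]
   is [generator T].  It also covers the analytic semigroups generated by
   operators that are not densely defined, which are not strongly continuous
   at 0 and for which [generator T] is only the part of [G] in the closure of
   its domain. *)
Definition generates (G : set (E * E)) T : Prop :=
  [/\ semigroup T,
      forall x (t : R), 0 < t -> T s x @[s --> t] --> T t x,
      exists M : R, forall t x, 0 < t <= 1 -> rnorm (T t x) <= M * rnorm x
    & exists w : R, forall l : R, w < l ->
        exists S : {linear E -> E}, is_resolvent G (l%:C)%C S /\
          forall x, is_bochner_integral `]0, +oo[
            (fun t => ((expR (- (l * t)))%:C)%C *: T t x) (S x)].

End Operators.

(* [iota : X -> Xm1] is a completion of [X] for the norm ||(Id + A)^-1 x||;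
   [A (y, x - y)] reads y = (Id + A)^-1 x. *)
Definition is_extrapolation (R : realType) (X : normedModType R[i])
    (A : set (X * X)) (Xm1 : completeNormedModType R[i])
    (iota : {linear X -> Xm1}) : Prop :=
  (forall x y, A (y, x - y) -> `|iota x| = `|y|) /\ dense (range iota).

Definition is_embedding (R : realType) (E F : normedModType R[i])
    (j : {linear E -> F}) : Prop := injective j /\ continuous j.

Definition op_part (R : realType) (E F : normedModType R[i])
    (j : {linear F -> E}) (A : set (E * E)) : set (F * F) :=
  [set xy | A (j xy.1, j xy.2)].

(* [k : Z -> W] identifies [Z] with D(A) under the norm ||z|| + ||A z||. *)
Definition is_graph_domain (R : realType) (W Z : normedModType R[i])
    (A : set (W * W)) (k : {linear Z -> W}) : Prop :=
  range k = op_dom A /\ forall z v, A (k z, v) -> `|z| = `|k z| + `|v|.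

(* The integral of T(t - s) f(s) over s in (0, t) exists in [E] and equals
   [v]. *)
Definition is_convolution (R : realType) (E : normedModType R[i])
    (T : R -> {linear E -> E}) (f : R -> E) (t : R) (v : E) : Prop :=
  is_bochner_integral `]0, t[ (fun s => T (t - s) (f s)) v.

(* f |-> T * f is bounded from L^p(0,oo; W) to L^p(0,oo; Z), where [k : Z -> W]
   is the inclusion of the domain of the generator. *)
Definition maximal_Lp_regularity (R : realType) (W Z : normedModType R[i])
    (k : {linear Z -> W}) (T : R -> {linear W -> W}) (p : R) : Prop :=
  exists K : R, forall f : R -> W, in_Lp p f ->
    exists g : R -> Z,
      [/\ {ae (@lebesgue_measure R), forall t, 0 < t ->
             is_convolution T f t (k (g t))},
          in_Lp p g
        & (Lp_norm p g <= K%:E * Lp_norm p f)%E].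

(* u |-> C (T * B u) is bounded from L^p_a(0,oo; U) to L^p_a(0,oo; Y); the
   convolution is taken in [W] and has values in [Z] almost everywhere. *)
Definition input_output_bounded (R : realType) (U W Z Y : normedModType R[i])
    (k : {linear Z -> W}) (T : R -> {linear W -> W})
    (B : {linear U -> W}) (C : {linear Z -> Y}) (p a : R) : Prop :=
  exists K : R, forall u : R -> U, in_Lpw p a u ->
    exists g : R -> Z,
      [/\ {ae (@lebesgue_measure R), forall t, 0 < t ->
             is_convolution T (B \o u) t (k (g t))},
          in_Lpw p a (C \o g)
        & (Lpw_norm p a (C \o g) <= K%:E * Lpw_norm p a u)%E].

(* Main.v *)
(* Fix c = e^(m-1) and t in [e c, e^2 c), and split the input f at c.  On
   [c, e^2 c) the weights s^alpha and t^alpha are comparable, so that part of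
   T * f is controlled by unweighted maximal regularity.  The part coming from
   (0, c) equals T(t - c) w with w = int_0^c T(c - s) f(s) ds, hence has graph
   norm at most (L / t) int_0^t |f|, and the weighted Hardy inequality bounds it
   because alpha < 1/p'.  Summing over m covers (0, oo).
   The estimate |T(t) x|_Z <= (L / t) |x| follows from maximal regularity alone,
   applied to f = 1_(0,c) T(.) x, for which (T * f)(s) = min(s, c) T(s) x. *)
Require Import Defs.
From HB Require Import structures.
From mathcomp Require Import all_boot all_order all_algebra.
From mathcomp Require Import complex.
From mathcomp Require Import all_classical all_reals all_analysis.
From mathcomp Require Import measurable_realfun.
From mathcomp Require Import ring lra.
Set Implicit Arguments.
Unset Strict Implicit.
Unset Printing Implicit Defensive.
Import Order.TTheory GRing.Theory Num.Theory.
Import numFieldNormedType.Exports.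
Import HBNNSimple.
Local Open Scope classical_set_scope.
Local Open Scope ring_scope.

(** * Real-valued norms *)

(** An input in the weighted space need not lie in L^p, so maximal regularity is applied once for
    each m, to the restriction of f to [c, e^2 c). For p-th powers the weight costs c^(-alpha p) on
    the input side and c^(alpha p) on the output side; these cancel, so the bound is uniform in m,
    and every time lies in only two of the intervals. Cutting at c, away from the output times,
    keeps t - c >= t/2, so the decay factor 1/(t - c) is of size 1/t; this lowers the weight
    exponent from alpha to alpha - 1, as in Hardy's inequality. The semigroup on W need not be
    strongly continuous at 0: continuity of orbits is used only at positive times, and boundedness
    on the half-line is obtained from boundedness near 0 and maximal regularity. The norm of a
    strongly measurable function agrees only almost everywhere with a Borel function, and the
    integral of a non-Borel function is a lower integral, monotone but not known to be additive.
    Norms are therefore replaced by Borel representatives before integrals are added. *)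

Section RealNorm.
Variables (R : realType) (E : normedModType R[i]).
Implicit Types x y : E.

Lemma rnormE x : `|x| = (rnorm x)%:C%C.
Proof. by rewrite /rnorm RRe_real // ger0_real. Qed.

Lemma rnorm_ge0 x : 0 <= rnorm x.
Proof. by rewrite -lecR -rnormE normr_ge0. Qed.

Lemma rnorm0 : rnorm (0 : E) = 0.
Proof. by rewrite /rnorm normr0. Qed.

Lemma rnorm0_eq0 x : rnorm x = 0 -> x = 0.
Proof. by move=> h; apply/eqP; rewrite -normr_eq0 rnormE h. Qed.

Lemma rnormD x y : rnorm (x + y) <= rnorm x + rnorm y.
Proof. by rewrite -lecR -rnormE rmorphD /= -!rnormE ler_normD. Qed.

Lemma rnormN x : rnorm (- x) = rnorm x.
Proof. by rewrite /rnorm normrN. Qed.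

Lemma rnormB x y : rnorm (x - y) <= rnorm x + rnorm y.
Proof. by rewrite -(rnormN y) rnormD. Qed.

Lemma rdistC x y : rnorm (x - y) = rnorm (y - x).
Proof. by rewrite -rnormN opprB. Qed.

Lemma rdist_triangle y x z : rnorm (x - z) <= rnorm (x - y) + rnorm (y - z).
Proof. by rewrite (le_trans _ (rnormD _ _)) // addrA subrK. Qed.

Lemma rnorm_rdist x y : rnorm x <= rnorm y + rnorm (x - y).
Proof. by rewrite (le_trans _ (rnormD _ _)) // addrC subrK. Qed.

Lemma rnormZ (a : R) x : rnorm (a%:C%C *: x) = `|a| * rnorm x.
Proof.
by rewrite /rnorm normrZ normc_def /= expr0n addr0 sqrtr_sqr rnormE /= mul0r subr0.
Qed.

Lemma cvg_rnorm (I : Type) (F : set_system I) {FF : Filter F} (f : I -> E) l :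
  f x @[x --> F] --> l <-> rnorm (l - f x) @[x --> F] --> (0 : R).
Proof.
split=> [/cvgrPdist_lt h|/cvgrPdist_lt h].
  apply/cvgrPdist_lt => e e0.
  have e0' : 0 < e%:C%C :> R[i] by rewrite ltcR.
  apply: filterS (h _ e0') => x.
  by rewrite rnormE ltcR sub0r normrN ger0_norm // rnorm_ge0.
apply/cvgrPdist_lt => e e0.
have eE : e = (complex.Re e)%:C%C by rewrite RRe_real // gtr0_real.
have e0' : 0 < complex.Re e by rewrite -ltcR -eE.
apply: filterS (h _ e0') => x.
by rewrite sub0r normrN ger0_norm ?rnorm_ge0 // rnormE eE ltcR.
Qed.

Lemma cvg_rnorm_le (I : Type) (F : set_system I) {FF : Filter F} (f : I -> E) l
    (e : I -> R) :
  (\forall x \near F, rnorm (l - f x) <= e x) ->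
  e x @[x --> F] --> (0 : R) -> f x @[x --> F] --> l.
Proof.
move=> fe e0; apply/cvg_rnorm.
apply: (@squeeze_cvgr _ _ _ _ (fun=> 0) e) => //; last exact: cvg_cst.
by apply: filterS fe => x ->; rewrite rnorm_ge0.
Qed.

Lemma cvg_rnorm_to (I : Type) (F : set_system I) {FF : Filter F} (f : I -> E) l :
  f x @[x --> F] --> l -> rnorm (f x) @[x --> F] --> rnorm l.
Proof.
move=> /cvg_rnorm /cvgrPdist_lt h; apply/cvgrPdist_lt => e /h.
apply: filterS => x; rewrite sub0r normrN ger0_norm ?rnorm_ge0 //.
apply: le_lt_trans; rewrite ler_norml lerNl opprB !lerBlDr !(addrC (rnorm (l - f x))).
by rewrite rnorm_rdist andbT rdistC rnorm_rdist.
Qed.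

End RealNorm.

Lemma rcauchy_cvg (R : realType) (E : completeNormedModType R[i]) (u : nat -> E) :
  (forall e : R, 0 < e -> exists N, forall m n, (N <= m)%N -> (N <= n)%N ->
     rnorm (u m - u n) <= e) -> cvgn u.
Proof.
move=> h; apply/cauchy_cvgP; apply: cauchy_exP => e e0.
have eE : e = (complex.Re e)%:C%C by rewrite RRe_real // gtr0_real.
have e0' : 0 < complex.Re e / 2 by rewrite divr_gt0 // -ltcR -eE.
have [N hN] := h _ e0'.
exists (u N), N => // n /= Nn; rewrite -ball_normE /= rnormE eE ltcR.
apply: (le_lt_trans (hN _ _ (leqnn N) Nn)).
by rewrite ltr_pdivrMr // ltr_pMr ?ltr1n // -ltcR -eE.
Qed.

Lemma linear_rnorm_le (R : realType) (E F : normedModType R[i]) (S : {linear E -> F}) :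
  continuous S -> exists M : R, 0 <= M /\ forall x, rnorm (S x) <= M * rnorm x.
Proof.
move=> /linear_bounded_continuous /linear_boundedP /pinfty_ex_gt0 [M M0 hM].
have ME : M = (complex.Re M)%:C%C by rewrite RRe_real // gtr0_real.
exists (complex.Re M); split=> [|x]; first by rewrite -lecR -ME ltW.
by rewrite -lecR -rnormE (le_trans (hM x)) // {1}ME rnormE -rmorphM.
Qed.

(** * Strong measurability *)

#[local] Instance ae_lebesgue_filter (R : realType) :
  Filter (nbhs (almost_everywhere (@lebesgue_measure R))) :=
  ae_filter_ringOfSetsType _.

Section FiniteRange.
Variable R : realType.

(* [simple_fun] without a normed codomain *)
Definition fin_fun (Q : Type) (q : R -> Q) : Prop :=
  finite_set (range q) /\ forall x, measurable (q @^-1` [set x]).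

Lemma fin_fun_preimage (Q : Type) (q : R -> Q) (A : set Q) :
  fin_fun q -> measurable (q @^-1` A).
Proof.
move=> [fq mq].
have -> : q @^-1` A = \bigcup_(x in range q `&` A) q @^-1` [set x].
  apply/seteqP; split=> [t /= At|t [x [_ Ax] /= ->] //].
  by exists (q t) => //; split=> //; exists t.
by apply: fin_bigcup_measurable => //; exact: finite_setIl.
Qed.

Lemma fin_fun_comp (Q Q' : Type) (phi : Q -> Q') (q : R -> Q) :
  fin_fun q -> fin_fun (phi \o q).
Proof.
move=> hq; split=> [|x]; last first.
  by rewrite comp_preimage; exact: fin_fun_preimage.
by rewrite -(image_comp q phi setT); case: hq => /(finite_image phi).
Qed.

Lemma fin_fun_pair (Q Q' : Type) (q : R -> Q) (q' : R -> Q') :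
  fin_fun q -> fin_fun q' -> fin_fun (fun t => (q t, q' t)).
Proof.
move=> [fq mq] [fq' mq']; split=> [|[x y]].
  apply: (sub_finite_set _ (finite_setX fq fq')) => _ [t _ <-].
  by split; exists t.
have -> : (fun t => (q t, q' t)) @^-1` [set (x, y)] =
    q @^-1` [set x] `&` q' @^-1` [set y].
  by apply/seteqP; split=> [t [<- <-]|t [/= -> ->]].
exact: measurableI.
Qed.

Lemma fin_fun_cst (Q : Type) (x : Q) : fin_fun (fun=> x).
Proof.
split=> [|y]; first by apply: (sub_finite_set _ (finite_set1 x)) => _ [t _ <-].
by rewrite preimage_cst; case: ifP.
Qed.

Lemma fin_fun_mem (A : set R) : measurable A -> fin_fun (fun t => t \in A).
Proof.
move=> mA; split=> [|b].
  exact: finite_finset.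
have -> : (fun t => t \in A) @^-1` [set b] = if b then A else ~` A.
  apply/seteqP; split=> t /=.
    by move=> <-; case: ifPn => [/set_mem //|/negP h At]; apply: h; apply/mem_set.
  by case: b => [/mem_set //|h]; apply/negbTE/negP => /set_mem.
by case: b => //; exact: measurableC.
Qed.

Lemma fin_fun_nnsfun (h : {nnsfun R >-> R}) : fin_fun (h : R -> R).
Proof. by split=> [|x]; [exact: fimfunP|exact: measurable_funPTI]. Qed.

Lemma fin_fun_measurable d (T : sigmaRingType d) (q : R -> T) :
  fin_fun q -> measurable_fun setT q.
Proof. by move=> hq _ A _; rewrite setTI; exact: fin_fun_preimage. Qed.

End FiniteRange.

Section StronglyMeasurable.
Variable R : realType.
Notation mu := (@lebesgue_measure R).
Variable E : normedModType R[i].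
Implicit Types (D : set R) (f g : R -> E).

Lemma sm_ae_eq D f g : {ae mu, forall t, D t -> f t = g t} ->
  strongly_measurable D f -> strongly_measurable D g.
Proof.
move=> fg [s [hs sf]]; exists s; split=> //.
by apply: filterS2 fg sf => t + + Dt => /(_ Dt) <- /(_ Dt).
Qed.

Lemma sm_sub D D' f : D' `<=` D ->
  strongly_measurable D f -> strongly_measurable D' f.
Proof.
move=> DD' [s [hs sf]]; exists s; split=> //.
by apply: filterS sf => t + D't => /(_ (DD' _ D't)).
Qed.

Lemma sm_cst D (x : E) : strongly_measurable D (fun=> x).
Proof.
exists (fun _ _ => x); split=> [n|]; first exact: fin_fun_cst.
by apply: aeW => t _; exact: cvg_cst.
Qed.

Lemma sm_add D f g : strongly_measurable D f -> strongly_measurable D g ->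
  strongly_measurable D (fun t => f t + g t).
Proof.
move=> [s [hs sf]] [s' [hs' sg]].
exists (fun n t => s n t + s' n t); split=> [n|].
  exact: (fin_fun_comp (fun x => x.1 + x.2) (fin_fun_pair (hs n) (hs' n))).
by apply: filterS2 sf sg => t + + Dt => /(_ Dt) ? /(_ Dt) ?; exact: cvgD.
Qed.

Lemma sm_linear (F : normedModType R[i]) (S : {linear E -> F}) D f :
  continuous S -> strongly_measurable D f -> strongly_measurable D (S \o f).
Proof.
move=> cS [s [hs sf]]; exists (fun n => S \o s n); split=> [n|].
  exact: (fin_fun_comp S (hs n)).
apply: filterS sf => t + Dt => /(_ Dt) h.
exact: (continuous_cvg _ (cS _) h).
Qed.

Lemma sm_opp D f : strongly_measurable D f ->
  strongly_measurable D (fun t => - f t).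
Proof.
move=> [s [hs sf]]; exists (fun n t => - s n t); split=> [n|].
  exact: (fin_fun_comp -%R (hs n)).
by apply: filterS sf => t + Dt => /(_ Dt) ?; exact: cvgN.
Qed.

Lemma sm_if D (A : set R) f g : measurable A ->
  strongly_measurable (D `&` A) f -> strongly_measurable (D `\` A) g ->
  strongly_measurable D (fun t => if t \in A then f t else g t).
Proof.
move=> mA [s [hs sf]] [s' [hs' sg]].
exists (fun n t => if t \in A then s n t else s' n t); split=> [n|].
  exact: (fin_fun_comp (fun x : bool * (E * E) => if x.1 then x.2.1 else x.2.2)
    (fin_fun_pair (fin_fun_mem mA) (fin_fun_pair (hs n) (hs' n)))).
apply: filterS2 sf sg => t h h' Dt.
by case: ifPn => [/set_mem At|/negP At]; [apply: h|apply: h'; split=> // /mem_set].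
Qed.

Lemma sm_simple D f : simple_fun f -> strongly_measurable D f.
Proof.
by move=> hf; exists (fun=> f); split=> //; apply: aeW => t _; exact: cvg_cst.
Qed.

(* [h n] are simple approximations of [phi] from below, composed with those of [f]. *)
Lemma sm_action (F : normedModType R[i]) (phi : R -> R) (T : R -> E -> F) D f :
  measurable_fun setT phi -> (forall t, 0 <= phi t) ->
  (forall t h s, D t -> (forall n, 0 <= h n <= phi t) ->
    h n @[n --> \oo] --> phi t -> s n @[n --> \oo] --> f t ->
    T (h n) (s n) @[n --> \oo] --> T (phi t) (f t)) ->
  strongly_measurable D f -> strongly_measurable D (fun t => T (phi t) (f t)).
Proof.
move=> mphi phi0 cT [s [hs sf]].
have mphi' : measurable_fun setT (EFin \o phi) by exact/measurable_EFinP.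
pose h : nat -> {nnsfun R >-> R} := nnsfun_approx measurableT mphi'.
have h_phi t : h n t @[n --> \oo] --> phi t.
  have h_phi : EFin \o h ^~ t @ \oo --> (phi t)%:E.
    by apply: cvg_nnsfun_approx => // x _; rewrite lee_fin.
  exact: (fine_cvg h_phi).
have h_le n t : 0 <= h n t <= phi t.
  rewrite fun_ge0 /= -lee_fin /h nnsfun_approxE.
  by apply: (@le_approx _ _ _ setT (EFin \o phi)) => // x _; rewrite lee_fin.
exists (fun n t => T (h n t) (s n t)); split=> [n|].
  exact: (fin_fun_comp (fun x => T x.1 x.2) (fin_fun_pair (fin_fun_nnsfun (h n)) (hs n))).
by apply: filterS sf => t + Dt => /(_ Dt) ?; exact: cT.
Qed.

Lemma sm_scale (phi : R -> R) D f :
  measurable_fun setT phi -> (forall t, 0 <= phi t) ->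
  strongly_measurable D f ->
  strongly_measurable D (fun t => (phi t)%:C%C *: f t).
Proof.
move=> mphi phi0 smf.
apply: (@sm_action _ phi (fun a x => a%:C%C *: x)) => // t h s Dt _ h_phi sf.
apply: cvgZ => //.
apply: (@cvg_rnorm_le _ R[i]^o _ _ _ _ _ (fun n => `|phi t - h n|)).
  by apply: nearW => n; rewrite -rmorphB /rnorm normc_def /= expr0n addr0 sqrtr_sqr.
rewrite -(@normr0 _ R) -(subrr (phi t)).
by apply: cvg_norm; apply: cvgB => //; exact: cvg_cst.
Qed.

(** The approximants converge only almost everywhere on [D], so the norm itself need not be Borel.
    The upper limit of their norms is Borel on the whole line and agrees with it wherever they
    converge; [fine] and the absolute value make it real and nonnegative elsewhere. *)
Lemma sm_norm D f : strongly_measurable D f ->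
  exists N : R -> R, [/\ measurable_fun setT N, forall t, 0 <= N t &
    {ae mu, forall t, D t -> rnorm (f t) = N t}].
Proof.
move=> [s [hs sf]].
pose u (t : R) n := (rnorm (s n t))%:E.
exists (fun t => `|fine (limn_esup (u t))|); split=> //.
- apply: measurableT_comp => //; apply: (measurableT_comp (fine_measurable _)) => //.
  apply: measurable_fun_limn_esup => n; apply/measurable_EFinP.
  by apply: fin_fun_measurable; exact: (fin_fun_comp (@rnorm _ E) (hs n)).
- apply: filterS sf => t + Dt => /(_ Dt) /cvg_rnorm_to h.
  have : u t n @[n --> \oo] --> (rnorm (f t))%:E.
    by apply: cvg_EFin; [exact: nearW|exact: h].
  by move=> /cvg_limn_einf_sup [_ ->]; rewrite /= ger0_norm ?rnorm_ge0.
Qed.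

End StronglyMeasurable.

(** * Lower integrals and simple integrals *)

Section LowerIntegral.
Variable R : realType.
Notation mu := (@lebesgue_measure R).

(* The integral of a non-measurable nonnegative function is a lower integral. *)
Lemma ae_le_lower_integral (D : set R) (f g : R -> \bar R) :
  (forall t, D t -> 0 <= f t)%E -> (forall t, D t -> 0 <= g t)%E ->
  {ae mu, forall t, D t -> (f t <= g t)%E} ->
  (\int[mu]_(t in D) f t <= \int[mu]_(t in D) g t)%E.
Proof.
move=> f0 g0 [N [mN N0 fgN]].
rewrite !ge0_integralE //; apply: ge_ereal_sup => _ [h hf <-].
have mN' : measurable (~` N) by exact: measurableC.
(* Cutting a simple minorant of [f] off the exceptional null set keeps its integral and makes it a
   minorant of [g] everywhere. *)
pose h' := mul_nnsfun h (indic_nnsfun R mN').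
suff -> : sintegral mu h = sintegral mu h'.
  apply: ereal_sup_ubound; exists h' => // t; have := hf t.
  rewrite /patch /h' /= /mindic indicE in_setC.
  case: ifPn => [/set_mem Dt|_]; last first.
    by apply: le_trans; rewrite lee_fin ler_piMr // ?fun_ge0 // lern1; case: (_ \in _).
  have [_|tN] := boolP (t \in N); first by rewrite mulr0 g0.
  rewrite mulr1 => /le_trans; apply.
  by apply: contrapT => gf; move/negP: tN; apply; apply/mem_set/fgN => /(_ Dt).
rewrite -!integralT_nnsfun; apply: ge0_ae_eq_integral => //.
- exact/measurable_EFinP.
- exact/measurable_EFinP.
- by move=> t _; rewrite lee_fin fun_ge0.
- by move=> t _; rewrite lee_fin fun_ge0.
exists N; split=> // t /= ht; apply: contrapT => tN; apply: ht => _.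
by rewrite /= /mindic indicE in_setC memNset // mulr1.
Qed.

Lemma ae_eq_lower_integral (D : set R) (f g : R -> \bar R) :
  (forall t, D t -> 0 <= f t)%E -> (forall t, D t -> 0 <= g t)%E ->
  {ae mu, forall t, D t -> f t = g t} ->
  (\int[mu]_(t in D) f t = \int[mu]_(t in D) g t)%E.
Proof.
move=> f0 g0 fg; apply/eqP; rewrite eq_le.
by rewrite !ae_le_lower_integral //; apply: filterS fg => t + Dt => ->.
Qed.

End LowerIntegral.

(** * Integrals of simple functions over a set of finite measure *)

Section SimpleIntegral.
Variables (R : realType) (D : set R).
Hypotheses (mD : measurable D) (finD : (lebesgue_measure D < +oo)%E).
Notation mu := (@lebesgue_measure R).
Implicit Types E F : normedModType R[i].

Let mass (A : set R) : R := fine (mu (D `&` A)).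

Let massE (A : set R) : measurable A -> (mass A)%:E = mu (D `&` A).
Proof.
move=> mA; rewrite /mass fineK // ge0_fin_numE //.
by apply: le_lt_trans finD; rewrite le_measure ?inE //; exact: measurableI.
Qed.

Lemma integrable_simple_finite E (s : R -> E) : simple_fun s -> integrable_simple D s.
Proof.
move=> [? ms]; split=> // x _; apply: le_lt_trans finD.
by rewrite le_measure ?inE //; exact: (measurableI _ _ mD (ms x)).
Qed.

(** Each fiber of [phi \o q] is a finite disjoint union of fibers of [q]. Computing through an
    arbitrary finite-valued [q] allows two simple functions to be paired into one, after which
    additivity holds term by term. *)
Lemma simple_integral_comp (Q : choiceType) E (phi : Q -> E) (q : R -> Q) :
  fin_fun q ->
  simple_integral D (phi \o q) =
  \sum_(c \in range q) (fine (mu (D `&` q @^-1` [set c])))%:C%C *: phi c.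
Proof.
move=> hq; have [fq mq] := hq.
have [fs ms] := fin_fun_comp phi hq.
rewrite /simple_integral.
have mass_fib x : mass ((phi \o q) @^-1` [set x]) =
    \sum_(c \in range q) (if phi c == x then mass (q @^-1` [set c]) else 0).
  apply: EFin_inj; rewrite massE //.
  transitivity (mu (\bigcup_(c in range q `&` phi @^-1` [set x])
      (D `&` q @^-1` [set c]))).
    congr (mu _); apply/seteqP; split=> [t [Dt /= qt]|t [c [_ /= <-] [Dt /= <-]] //].
    by exists (q t) => //; split=> //; exists t.
  rewrite measure_fin_bigcup; last 3 first.
  - exact: finite_setIl.
  - by move=> c c' _ _ [t [[_ /= <-] [_ /= <-]]].
  - by move=> c _; exact: (measurableI _ _ mD (mq c)).
  rewrite -fsumEFin // fsbig_mkcondr; apply: eq_fsbigr => c _.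
  rewrite /patch; case: ifPn => [/set_mem /= ->|/negP h]; first by rewrite eqxx massE.
  by case: eqP => // h'; case: h; apply/mem_set.
under eq_fsbigr do rewrite -/(mass _) mass_fib.
transitivity (\sum_(x \in range (phi \o q)) \sum_(c \in range q)
   (if phi c == x then (mass (q @^-1` [set c]))%:C%C *: phi c else 0)).
  apply: eq_fsbigr => x _.
  rewrite !fsbig_finite //= rmorph_sum scaler_suml; apply: eq_bigr => c _.
  by case: eqP => [->|_] //; rewrite scale0r.
rewrite exchange_fsbig //; apply: eq_fsbigr => c /set_mem [t _ <-].
rewrite (fsbigD1 (phi (q t))) /= ?eqxx //; last by exists t.
by rewrite fsbig1 ?addr0 // => x [_ /= /eqP]; rewrite eq_sym => /negbTE ->.
Qed.

Lemma simple_integralD E (s s' : R -> E) : simple_fun s -> simple_fun s' ->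
  simple_integral D (fun t => s t + s' t) =
  simple_integral D s + simple_integral D s'.
Proof.
move=> hs hs'; have hq := fin_fun_pair hs hs'.
rewrite (simple_integral_comp (fun x => x.1 + x.2) hq).
rewrite (simple_integral_comp fst hq) (simple_integral_comp snd hq).
rewrite -fsbig_split; last by case: hq.
by apply: eq_fsbigr => c _; rewrite /= -scalerDr.
Qed.

Lemma simple_integral_linear E F (S : {linear E -> F}) (s : R -> E) :
  simple_fun s -> simple_integral D (S \o s) = S (simple_integral D s).
Proof.
move=> hs; rewrite (simple_integral_comp S hs).
rewrite /simple_integral !fsbig_finite; try by case: hs.
by rewrite linear_sum; apply: eq_bigr => c _; rewrite linearZ.
Qed.

Lemma simple_integralB E (s s' : R -> E) : simple_fun s -> simple_fun s' ->
  simple_integral D (fun t => s t - s' t) =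
  simple_integral D s - simple_integral D s'.
Proof.
move=> hs hs'; rewrite simple_integralD //; last exact: (fin_fun_comp -%R hs').
by rewrite (simple_integral_linear -%R hs').
Qed.

Lemma simple_integral_le E (s : R -> E) : simple_fun s ->
  ((rnorm (simple_integral D s))%:E <= \int[mu]_(t in D) (rnorm (s t))%:E)%E.
Proof.
move=> hs; have [fs ms] := hs.
have -> : (\int[mu]_(t in D) (rnorm (s t))%:E =
    \sum_(x \in range s) (mass (s @^-1` [set x]) * rnorm x)%:E)%E.
  transitivity (\int[mu]_(t in D) \sum_(x \in range s)
      (rnorm x * \1_(s @^-1` [set x]) t)%:E)%E.
    apply: eq_integral => t _; rewrite (fsbigD1 (s t)) //=; last by exists t.
    rewrite indicE mem_set // mulr1 fsbig1 ?adde0 // => x [_ /= xs].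
    by rewrite indicE memNset ?mulr0 // => /= h; apply: xs.
  rewrite ge0_integral_fsum //; last 2 first.
  - move=> x; apply/measurable_EFinP; apply: measurable_funM => //.
    exact: (measurable_indic (ms x)).
  - by move=> x t _; rewrite lee_fin mulr_ge0 ?rnorm_ge0.
  apply: eq_fsbigr => x _.
  under eq_integral do rewrite EFinM.
  rewrite ge0_integralZl ?lee_fin ?rnorm_ge0 //.
    by rewrite integral_indic //; [rewrite EFinM massE // setIC muleC|exact: ms].
  by apply/measurable_EFinP; exact: (measurable_indic (ms x)).
rewrite fsumEFin // lee_fin /simple_integral !fsbig_finite //.
elim/big_rec2: _ => [|x y v _ h]; first by rewrite rnorm0.
rewrite (le_trans (rnormD _ _)) // lerD // rnormZ ger0_norm //.
exact: fine_ge0.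
Qed.

End SimpleIntegral.

(** * The Bochner integral *)

Section BochnerIntegral.
Variables (R : realType) (D : set R).
Hypotheses (mD : measurable D) (finD : (lebesgue_measure D < +oo)%E).
Notation mu := (@lebesgue_measure R).
Implicit Types E F : normedModType R[i].

(* The error [rnorm (f t - s n t)] need not be Borel; [e n] dominates it. *)
Definition bochner_approx E (f : R -> E) (v : E) (s : nat -> R -> E) (e : nat -> R -> R) :=
  [/\ forall n, simple_fun (s n),
      forall n, measurable_fun setT (e n) /\ forall t, 0 <= e n t,
      {ae mu, forall t n, D t -> rnorm (f t - s n t) <= e n t},
      (\int[mu]_(t in D) (e n t)%:E)%E @[n --> \oo] --> 0%E
    & simple_integral D (s n) @[n --> \oo] --> v].

Lemma bochnerP E (f : R -> E) v : is_bochner_integral D f v <->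
  strongly_measurable D f /\ exists s e, bochner_approx f v s e.
Proof.
split=> [[smf [s [hs fs sv]]]|[smf [s [e [hs he fe e0 sv]]]]]; split=> //; last first.
  exists s; split=> // [n|]; first exact: integrable_simple_finite.
  apply: (@squeeze_cvge _ _ _ _ (fun=> 0%E) _
    (fun n => \int[mu]_(t in D) (e n t)%:E)%E) => //; last exact: cvg_cst.
  apply: nearW => n; rewrite integral_ge0 /= => [|t _]; last by rewrite lee_fin rnorm_ge0.
  apply: ae_le_lower_integral => [t _|t _|]; rewrite ?lee_fin ?rnorm_ge0 ?(proj2 (he n)) //.
  by apply: filterS fe => t + Dt => /(_ n Dt); rewrite lee_fin.
have hs' n : simple_fun (s n) by case: (hs n).
have sme n : strongly_measurable D (fun t => f t - s n t).
  by apply: sm_add => //; apply: sm_opp; exact: sm_simple.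
pose e n := sval (cid (sm_norm (sme n))).
have he n : [/\ measurable_fun setT (e n), forall t, 0 <= e n t &
    {ae mu, forall t, D t -> rnorm (f t - s n t) = e n t}].
  exact: (svalP (cid (sm_norm (sme n)))).
exists s, e; split=> //.
- by move=> n; case: (he n).
- have : {ae mu, forall t n, D t -> rnorm (f t - s n t) = e n t}.
    by apply/ae_foralln => n; case: (he n).
  by apply: filterS => t + n Dt => /(_ n Dt) ->.
- rewrite -(_ : (fun n => \int[mu]_(t in D) (rnorm (f t - s n t))%:E)%E =
      (fun n => \int[mu]_(t in D) (e n t)%:E)%E) //.
  apply/funext => n; have [_ e0 fe] := he n.
  apply: ae_eq_lower_integral => [t _|t _|]; rewrite ?lee_fin ?rnorm_ge0 //.
  by apply: filterS fe => t + Dt => /(_ Dt) ->.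
Qed.

(** The bound for simple functions passes to the limit because the integral of the error tends to 0.
    The majorant [N] is Borel so that its integral can be added to that of the error. *)
Lemma bochner_rnorm_le E (f : R -> E) v (N : R -> R) :
  measurable_fun setT N -> (forall t, 0 <= N t) ->
  {ae mu, forall t, D t -> rnorm (f t) <= N t} ->
  is_bochner_integral D f v ->
  ((rnorm v)%:E <= \int[mu]_(t in D) (N t)%:E)%E.
Proof.
move=> mN N0 fN /bochnerP [smf [s [e [hs he fe e0 sv]]]].
have mNe (g : R -> R) : measurable_fun setT g -> measurable_fun D (EFin \o g).
  by move=> mg; apply/measurable_EFinP; exact: measurable_funTS.
have hle n : ((rnorm (simple_integral D (s n)))%:E <=
    \int[mu]_(t in D) (N t)%:E + \int[mu]_(t in D) (e n t)%:E)%E.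
  have [me e_ge0] := he n.
  rewrite -ge0_integralD //; last 4 first.
  - by move=> t _; rewrite lee_fin.
  - exact: mNe.
  - by move=> t _; rewrite lee_fin.
  - exact: mNe.
  apply: (le_trans (simple_integral_le mD finD (hs n))).
  apply: ae_le_lower_integral => [t _|t _|]; rewrite -?EFinD ?lee_fin ?rnorm_ge0 ?addr_ge0 //.
  apply: filterS2 fN fe => t + + Dt => /(_ Dt) h /(_ n Dt) h'.
  by rewrite -EFinD lee_fin (le_trans (rnorm_rdist _ (f t))) // rdistC lerD.
have hl : (rnorm (simple_integral D (s n)))%:E @[n --> \oo] --> (rnorm v)%:E.
  by apply: cvg_EFin; [exact: nearW|exact: cvg_rnorm_to].
have hr : (\int[mu]_(t in D) (N t)%:E + \int[mu]_(t in D) (e n t)%:E)%E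
    @[n --> \oo] --> (\int[mu]_(t in D) (N t)%:E + 0)%E.
  by apply: cvgeD => //; [rewrite fin_num_adde_defl|exact: cvg_cst].
by rewrite adde0 in hr; exact: (lee_cvg_to hl hr (nearW _ hle)).
Qed.

Lemma bochner_ae_eq E (f g : R -> E) v :
  {ae mu, forall t, D t -> f t = g t} ->
  is_bochner_integral D f v -> is_bochner_integral D g v.
Proof.
move=> fg /bochnerP [smf [s [e [hs he fe e0 sv]]]]; apply/bochnerP.
split; first exact: sm_ae_eq smf.
exists s, e; split=> //; apply: filterS2 fg fe => t + + n Dt.
by move=> /(_ Dt) <- /(_ n Dt).
Qed.

Lemma bochner_add E (f g : R -> E) v w :
  is_bochner_integral D f v -> is_bochner_integral D g w ->
  is_bochner_integral D (fun t => f t + g t) (v + w).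
Proof.
move=> /bochnerP [smf [s [e [hs he fe e0 sv]]]].
move=> /bochnerP [smg [s' [e' [hs' he' ge' e'0 sw]]]].
apply/bochnerP; split; first exact: sm_add.
exists (fun n t => s n t + s' n t), (fun n t => e n t + e' n t); split.
- by move=> n; exact: (fin_fun_comp (fun x => x.1 + x.2) (fin_fun_pair (hs n) (hs' n))).
- move=> n; have [? ?] := he n; have [? ?] := he' n.
  by split=> [|t]; [exact: measurable_funD|rewrite addr_ge0].
- apply: filterS2 fe ge' => t + + n Dt => /(_ n Dt) h /(_ n Dt) h'.
  by rewrite opprD addrACA (le_trans (rnormD _ _)) // lerD.
- rewrite (_ : (fun n => _) = (fun n => \int[mu]_(t in D) (e n t)%:E +
      \int[mu]_(t in D) (e' n t)%:E)%E); last first.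
    apply/funext => n; have [? ?] := he n; have [? ?] := he' n.
    under eq_integral do rewrite EFinD.
    rewrite ge0_integralD //.
    + by move=> t _; rewrite lee_fin.
    + by apply/measurable_EFinP; exact: measurable_funTS.
    + by move=> t _; rewrite lee_fin.
    + by apply/measurable_EFinP; exact: measurable_funTS.
  by rewrite -[X in _ --> X]adde0; exact: cvgeD.
- under eq_fun do rewrite simple_integralD //.
  exact: cvgD.
Qed.

Lemma bochner_linear E F (S : {linear E -> F}) (f : R -> E) v : continuous S ->
  is_bochner_integral D f v -> is_bochner_integral D (S \o f) (S v).
Proof.
move=> cS /bochnerP [smf [s [e [hs he fe e0 sv]]]].
have [M [M0 SM]] := linear_rnorm_le cS.
apply/bochnerP; split; first exact: sm_linear.
exists (fun n => S \o s n), (fun n t => M * e n t); split.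
- by move=> n; exact: (fin_fun_comp S (hs n)).
- move=> n; have [? ?] := he n.
  by split=> [|t]; [exact: measurable_funM|rewrite mulr_ge0].
- apply: filterS fe => t + n Dt => /(_ n Dt) h.
  by rewrite /= -linearB (le_trans (SM _)) // ler_wpM2l.
- rewrite (_ : (fun n => _) = (fun n => M%:E * \int[mu]_(t in D) (e n t)%:E)%E); last first.
    apply/funext => n; have [? ?] := he n.
    under eq_integral do rewrite EFinM.
    rewrite ge0_integralZl ?lee_fin //; last by move=> t _; rewrite lee_fin.
    by apply/measurable_EFinP; exact: measurable_funTS.
  have h : (M%:E * \int[mu]_(t in D) (e n t)%:E)%E @[n --> \oo] --> (M%:E * 0)%E.
    exact: cvgeZl.
  by rewrite mule0 in h.
- under eq_fun do rewrite simple_integral_linear //.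
  exact: (continuous_cvg _ (cS _) sv).
Qed.

Lemma bochner_simple E (s : R -> E) : simple_fun s ->
  is_bochner_integral D s (simple_integral D s).
Proof.
move=> hs; apply/bochnerP; split; first exact: sm_simple.
exists (fun=> s), (fun _ _ => 0); split=> //.
- by apply: aeW => t n _; rewrite subrr rnorm0.
- under eq_fun do rewrite integral0.
  exact: cvg_cst.
- exact: cvg_cst.
Qed.

Lemma bochner_cst E (x : E) :
  is_bochner_integral D (fun=> x) ((fine (mu D))%:C%C *: x).
Proof.
have := bochner_simple (fin_fun_cst R x : simple_fun (fun=> x)).
rewrite /simple_integral (_ : range _ = [set x]); last first.
  by apply/seteqP; split=> [_ [t _ <-] //|_ ->]; exists 0.
by rewrite fsbig_set1 (_ : _ @^-1` _ = setT) ?setIT //; apply/seteqP.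
Qed.

(** The norm bound with majorant 0 applies to [v - w], an integral of [f - f]. *)
Lemma bochner_unique E (f : R -> E) v w :
  is_bochner_integral D f v -> is_bochner_integral D f w -> v = w.
Proof.
move=> fv fw.
have fNw : is_bochner_integral D (-%R \o f) (- w).
  by apply: (@bochner_linear _ _ -%R) fw => x; exact: opp_continuous.
have h := bochner_rnorm_le (measurable_cst (0 : R)) (fun=> lexx _) _ (bochner_add fv fNw).
apply/eqP; rewrite -subr_eq0; apply/eqP/rnorm0_eq0/eqP.
rewrite eq_le rnorm_ge0 andbT -lee_fin.
apply: (le_trans (h _)); last by rewrite integral0.
by apply: aeW => t _; rewrite /= subrr rnorm0.
Qed.

(** The approximants [s0] converge pointwise but need not be dominated. Set to 0 where their norm
    exceeds [2 * N], they leave errors at most [3 * N], so dominated convergence applies and their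
    integrals form a Cauchy sequence. *)
Lemma bochner_exists (E : completeNormedModType R[i]) (f : R -> E) (N : R -> R) :
  strongly_measurable D f -> measurable_fun setT N -> (forall t, 0 <= N t) ->
  {ae mu, forall t, D t -> rnorm (f t) <= N t} ->
  (\int[mu]_(t in D) (N t)%:E < +oo)%E ->
  exists v, is_bochner_integral D f v.
Proof.
move=> smf mN N0 fN iN; have [s0 [hs0 sf]] := smf.
(* The factor 2 leaves room: where [N t] is positive, the limit has norm strictly below [2 * N t],
   so the truncation is eventually inactive; where [N t = 0], both [f t] and the truncated values
   vanish. *)
pose A n := [set t | rnorm (s0 n t) <= 2 * N t].
have mA n : measurable (A n).
  have /(_ measurableT [set true]) : measurable_fun setT
      (fun t => rnorm (s0 n t) <= 2 * N t).
    apply: measurable_fun_ler; last exact: measurable_funM.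
    by apply: fin_fun_measurable; exact: (fin_fun_comp (@rnorm _ E) (hs0 n)).
  by rewrite setTI; exact.
pose s n t := if t \in A n then s0 n t else 0.
have hs n : simple_fun (s n).
  exact: (fin_fun_comp (fun x : bool * E => if x.1 then x.2 else 0)
    (fin_fun_pair (fin_fun_mem (mA n)) (hs0 n))).
have s_le n t : rnorm (s n t) <= 2 * N t.
  by rewrite /s; case: ifPn => [/set_mem //|_]; rewrite rnorm0 mulr_ge0.
have s_f : {ae mu, forall t, D t -> s n t @[n --> \oo] --> f t}.
  apply: filterS2 fN sf => t + + Dt => /(_ Dt) h /(_ Dt) h'.
  have [Nt0|Nt0] := eqVneq (N t) 0.
    have z x : rnorm x <= 0 -> x = 0 :> E.
      by move=> x0; apply: rnorm0_eq0; apply/eqP; rewrite eq_le x0 rnorm_ge0.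
    rewrite (z (f t)) -?Nt0 //; under eq_fun => n.
      rewrite (z (s n t)); last by rewrite -(mulr0 2) -Nt0.
      over.
    exact: cvg_cst.
  apply: (cvg_trans _ h'); apply: near_eq_cvg.
  have ltN : rnorm (f t) < 2 * N t.
    by rewrite (le_lt_trans h) // mulr_natl mulr2n ltrDl lt_def Nt0 N0.
  have : \forall n \near \oo, rnorm (s0 n t) < 2 * N t.
    exact: (cvgr_lt _ (cvg_rnorm_to h')).
  by apply: filterS => n hn; rewrite /s mem_set //; exact: ltW.
have sme n : strongly_measurable D (fun t => f t - s n t).
  by apply: sm_add => //; apply: sm_opp; exact: sm_simple.
pose e n := sval (cid (sm_norm (sme n))).
have he n : [/\ measurable_fun setT (e n), forall t, 0 <= e n t &
    {ae mu, forall t, D t -> rnorm (f t - s n t) = e n t}].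
  exact: (svalP (cid (sm_norm (sme n)))).
have me n : measurable_fun D (EFin \o e n).
  by apply/measurable_EFinP; apply: measurable_funTS; case: (he n).
have fe : {ae mu, forall t n, D t -> rnorm (f t - s n t) = e n t}.
  by apply/ae_foralln => n; case: (he n).
have e_to0 : (\int[mu]_(t in D) (e n t)%:E)%E @[n --> \oo] --> 0%E.
  have := @dominated_convergence _ _ _ mu _ mD (fun n => EFin \o e n) (fun=> 0%E)
    (fun t => (3 * N t)%:E) me.
  case.
  - exact: measurable_cst.
  - apply: filterS2 fe s_f => t h + Dt => /(_ Dt) /cvg_rnorm.
    under eq_fun do rewrite h //.
    by move=> ?; apply: cvg_EFin => //; exact: nearW.
  - apply/integrableP; split.
      by apply/measurable_EFinP/measurable_funTS; exact: measurable_funM.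
    under eq_integral do rewrite gee0_abs ?lee_fin ?mulr_ge0 // EFinM.
    rewrite ge0_integralZl ?lee_fin //; last by move=> t _; rewrite lee_fin.
      by rewrite lte_mul_pinfty ?lee_fin.
    by apply/measurable_EFinP/measurable_funTS.
  - apply: filterS2 fe fN => t h h' n Dt.
    rewrite gee0_abs /= ?lee_fin -?h ?rnorm_ge0 // (le_trans (rnormB _ _)) //.
    by rewrite -[3]/((1 + 2)%N%:R) natrD mulrDl mul1r lerD // h'.
  by move=> _ _; rewrite integral0.
have : cvgn (fun n => simple_integral D (s n)).
  apply: rcauchy_cvg => eps eps0.
  have eps2 : 0 < eps / 2 by rewrite divr_gt0.
  have [n0 _ hn0] := e_to0 _ (@nbhs_open_ereal_lt _ 0 (fun=> eps / 2) eps2).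
  exists n0 => m n n0m n0n.
  rewrite -simple_integralB // -lee_fin.
  have smn : simple_fun (fun t => s m t - s n t).
    exact: (fin_fun_comp (fun x => x.1 - x.2) (fin_fun_pair (hs m) (hs n))).
  apply: (le_trans (simple_integral_le mD finD smn)).
  apply: (@le_trans _ _ (\int[mu]_(t in D) ((e m t)%:E + (e n t)%:E))%E).
    apply: ae_le_lower_integral => [t _|t _|].
    - by rewrite lee_fin rnorm_ge0.
    - by rewrite -EFinD lee_fin addr_ge0 //; [case: (he m)|case: (he n)].
    apply: filterS fe => t h Dt; rewrite -EFinD lee_fin -!h //.
    by rewrite (rdistC (f t)) rdist_triangle.
  rewrite ge0_integralD //.
  - by rewrite [eps]splitr EFinD leeD // ltW //; exact: hn0.
  - by move=> t _; rewrite lee_fin; case: (he m).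
  - exact: me.
  - by move=> t _; rewrite lee_fin; case: (he n).
  - exact: me.
move=> /cvg_ex [v sv]; exists v; apply/bochnerP; split=> //.
exists s, e; split=> //; first by move=> n; case: (he n).
by apply: filterS fe => t h n Dt; rewrite h.
Qed.

End BochnerIntegral.

(** Extension by zero turns an integral over a subinterval into one over the full interval on which
    [is_convolution] is stated. *)
Lemma bochner_restrict (R : realType) (D D' : set R) (E : normedModType R[i])
    (f : R -> E) (v : E) :
  measurable D -> (lebesgue_measure D < +oo)%E -> measurable D' -> D' `<=` D ->
  is_bochner_integral D' f v ->
  is_bochner_integral D (fun t => if t \in D' then f t else 0) v.
Proof.
move=> mD finD mD' D'D.
have finD' : (lebesgue_measure D' < +oo)%E.
  by apply: le_lt_trans finD; rewrite le_measure ?inE.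
move=> /(bochnerP mD' finD') [smf [s [e [hs he fe e0 sv]]]]; apply/(bochnerP mD finD).
split.
  apply: sm_if => //; last exact: sm_cst.
  by apply: sm_sub smf; exact: subIsetr.
exists (fun n t => if t \in D' then s n t else 0).
exists (fun n t => if t \in D' then e n t else 0); split.
- move=> n; exact: (fin_fun_comp (fun x : bool * E => if x.1 then x.2 else 0)
    (fin_fun_pair (fin_fun_mem mD') (hs n))).
- move=> n; have [? ?] := he n; split=> [|t]; last by case: ifP.
  apply: measurable_fun_ifT => //.
  exact: fin_fun_measurable (fin_fun_mem mD').
- apply: filterS fe => t h n Dt; case: ifPn => [/set_mem D't|_]; first exact: h.
  by rewrite subrr rnorm0.
- rewrite -(_ : (fun n => \int[lebesgue_measure]_(t in D') (e n t)%:E)%E =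
    (fun n => \int[lebesgue_measure]_(t in D) (if t \in D' then e n t else 0)%:E)%E) //.
  apply/funext => n; rewrite -[in LHS](setIidr D'D) integral_mkcondr.
  by apply: eq_integral => t _; rewrite /patch; case: ifP.
- rewrite -(_ : (fun n => simple_integral D' (s n)) =
    (fun n => simple_integral D (fun t => if t \in D' then s n t else 0))) //.
  apply/funext => n.
  have hq := fin_fun_pair (fin_fun_mem mD') (hs n).
  rewrite (simple_integral_comp mD finD (fun x : bool * E => if x.1 then x.2 else 0) hq).
  rewrite (simple_integral_comp mD' finD' snd hq).
  apply: eq_fsbigr => -[[] x] _ /=.
    congr ((fine (lebesgue_measure _))%:C%C *: _); apply/seteqP; split=> t [h [tD' sx]].
      by split; [exact: D'D|rewrite /= tD' sx].
    by split; [exact: set_mem|rewrite /= tD' sx].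
  rewrite scaler0 (_ : _ `&` _ = set0) ?measure0 ?scale0r //.
  by apply/seteqP; split=> // t [D't [/negP]]; rewrite mem_set.
Qed.

(** * Hardy's inequality *)

Section PowerIntegrals.
Variable R : realType.
Notation mu := (@lebesgue_measure R).

Lemma is_derive_powR_div (r x : R) : r != 0 -> 0 < x ->
  is_derive x 1 (fun t : R => r^-1 * t `^ r) (x `^ (r - 1)).
Proof.
move=> r0 x0; have := is_derive1_powR r x0 => h.
have := @is_deriveZ _ _ _ (@powR R ^~ r) r^-1 x 1 _ h.
by rewrite /GRing.scale /= mulrA mulVf // mul1r.
Qed.

Lemma powR_continuous (r x : R) : 0 < x -> {for x, continuous (@powR R ^~ r)}.
Proof.
move=> x0; apply: differentiable_continuous; apply/derivable1_diffP.
by apply: derivable_powR; rewrite in_itv /= x0.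
Qed.

Lemma integral_powR (r x y : R) : r != 0 -> 0 < x -> x < y ->
  (\int[mu]_(t in `[x, y]) (t `^ (r - 1))%:E =
   (r^-1 * y `^ r)%:E - (r^-1 * x `^ r)%:E)%E.
Proof.
move=> r0 x0 xy.
have gt0 (t : R) : x <= t -> 0 < t by exact: lt_le_trans.
have dF (t : R) : x <= t -> is_derive t 1 (fun t : R => r^-1 * t `^ r) (t `^ (r - 1)).
  by move=> xt; apply: is_derive_powR_div => //; exact: gt0.
have cF (t : R) : x <= t -> {for t, continuous (fun t : R => r^-1 * t `^ r)}.
  move=> xt; apply: differentiable_continuous; apply/derivable1_diffP.
  by case: (dF t xt).
apply: (@continuous_FTC2 _ _ (fun t : R => r^-1 * t `^ r) _ _ xy).
- apply: continuous_in_subspaceT => t /set_mem; rewrite /= in_itv /= => /andP[xt _].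
  by apply: powR_continuous; exact: gt0.
- split.
  + by move=> t; rewrite in_itv /= => /andP[/ltW /dF [] //].
  + by apply: cvg_at_right_filter; exact: cF.
  + by apply: cvg_at_left_filter; apply: cF; exact: ltW.
- move=> t; rewrite in_itv /= => /andP[/ltW /dF h _].
  by rewrite derive1E; exact: derive_val.
Qed.

(** Monotone convergence, used to carry [integral_powR] from compact intervals to the improper
    integrals at 0 and at infinity. *)
Lemma integral_bigcup_le (F : nat -> set R) (f : R -> \bar R) (B : \bar R) :
  {homo F : n m / (n <= m)%N >-> n `<=` m} -> (forall n, measurable (F n)) ->
  measurable_fun setT f -> (forall t, 0 <= f t)%E ->
  (forall n, \int[mu]_(t in F n) f t <= B)%E ->
  (\int[mu]_(t in \bigcup_n F n) f t <= B)%E.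
Proof.
move=> hF mF mf f0 fB.
have h : (\int[mu]_(t in F n) f t)%E @[n --> \oo] --> (\int[mu]_(t in \bigcup_n F n) f t)%E.
  apply: ge0_nondecreasing_set_cvg_integral => //.
  - by move=> n m nm; apply/subsetPset; exact: hF.
  - by move=> n; exact: measurable_funTS.
rewrite -(cvg_lim _ h) //; apply: lime_le; first by apply/cvg_ex; eexists; exact: h.
exact: nearW.
Qed.

Lemma measurable_powRE (r : R) : measurable_fun setT (fun t : R => (t `^ r)%:E).
Proof. by apply/measurable_EFinP; exact: measurable_powR. Qed.

Lemma integral_powR_near0 (r y : R) : 0 < r -> 0 < y ->
  (\int[mu]_(t in `]0%R, y[) (t `^ (r - 1))%:E <= (r^-1 * y `^ r)%:E)%E.
Proof.
move=> r0 y0.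
(* With [n.+2] the interval from [y / n.+2] to [y] is nondegenerate already for [n = 0], as
   [integral_powR] requires. *)
have pos n : 0 < y / n.+2%:R by rewrite divr_gt0.
pose F n : set R := [set` `[y / n.+2%:R, y]].
apply: (@le_trans _ _ (\int[mu]_(t in \bigcup_n F n) (t `^ (r - 1))%:E)%E).
  apply: ge0_subset_integral => //.
  - by apply: bigcupT_measurable => n; exact: measurable_itv.
  - apply: measurable_funTS; exact: measurable_powRE.
  - by move=> t _; rewrite lee_fin powR_ge0.
  move=> t /=; rewrite in_itv /= => /andP[t0 ty].
  exists (Num.trunc (y / t)) => //; rewrite /F /= in_itv /= (ltW ty) andbT.
  rewrite ler_pdivrMr // mulrC -ler_pdivrMr //.
  by rewrite (le_trans (ltW (truncnS_gt _))) // ler_nat.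
apply: integral_bigcup_le => //.
- move=> n m nm t; rewrite /F /= !in_itv /= => /andP[h ->]; rewrite andbT.
  by rewrite (le_trans _ h) // ler_pM2l // lef_pV2 ?posrE // ler_nat.
- by move=> n; exact: measurable_itv.
- exact: measurable_powRE.
- by move=> t; rewrite lee_fin powR_ge0.
move=> n; rewrite integral_powR ?gt_eqF // ?lte_fin.
  by rewrite -EFinB lee_fin gerBl mulr_ge0 ?powR_ge0 // invr_ge0 ltW.
by rewrite ltr_pdivrMr // ltr_pMr // ltr1n.
Qed.

Lemma integral_powR_neary (d x : R) : 0 < d -> 0 < x ->
  (\int[mu]_(t in `]x, +oo[) (t `^ (- d - 1))%:E <= (d^-1 * x `^ (- d))%:E)%E.
Proof.
move=> d0 x0.
pose F n : set R := [set` `[x, x + n.+1%:R]].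
apply: (@le_trans _ _ (\int[mu]_(t in \bigcup_n F n) (t `^ (- d - 1))%:E)%E).
  apply: ge0_subset_integral => //.
  - by apply: bigcupT_measurable => n; exact: measurable_itv.
  - apply: measurable_funTS; exact: measurable_powRE.
  - by move=> t _; rewrite lee_fin powR_ge0.
  move=> t /=; rewrite in_itv /= andbT => xt.
  exists (Num.trunc (t - x)) => //; rewrite /F /= in_itv /= (ltW xt) /=.
  by rewrite -lerBlDl ltW // truncnS_gt.
apply: integral_bigcup_le => //.
- move=> n m nm t; rewrite /F /= !in_itv /= => /andP[-> h] /=.
  by rewrite (le_trans h) // lerD2l ler_nat.
- by move=> n; exact: measurable_itv.
- exact: measurable_powRE.
- by move=> t; rewrite lee_fin powR_ge0.
move=> n; rewrite integral_powR ?oppr_eq0 ?gt_eqF ?ltrDl //.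
rewrite -EFinB lee_fin invrN !mulNr opprK gerDr oppr_le0.
by rewrite mulr_ge0 ?powR_ge0 // invr_ge0 ltW.
Qed.

End PowerIntegrals.

Section Hardy.
Variable R : realType.
Notation mu := (@lebesgue_measure R).
Implicit Types f g N : R -> R.

Lemma hoelder_integral_powR (D : set R) f g (p q : R) : measurable D ->
  measurable_fun setT f -> measurable_fun setT g ->
  (forall t, 0 <= f t) -> (forall t, 0 <= g t) ->
  0 < p -> 0 < q -> p^-1 + q^-1 = 1 ->
  ((\int[mu]_(t in D) (f t * g t)%:E) `^ p <=
   (\int[mu]_(t in D) (f t `^ q)%:E) `^ (p / q) *
   \int[mu]_(t in D) (g t `^ p)%:E)%E.
Proof.
move=> mD mf mg f0 g0 p0 q0 pq.
(* [hoelder] concerns the whole line; the indicator factors localise it to [D]. *)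
pose F t := f t * \1_D t; pose G t := g t * \1_D t.
have mF : measurable_fun setT F by apply: measurable_funM => //; exact: measurable_indic.
have mG : measurable_fun setT G by apply: measurable_funM => //; exact: measurable_indic.
have F0 t : 0 <= F t by rewrite mulr_ge0.
have G0 t : 0 <= G t by rewrite mulr_ge0.
have restr (h : R -> R) r : (forall t, 0 <= h t) -> r != 0 ->
    (\int[mu]_(t in D) (h t `^ r)%:E = \int[mu]_t (`|(h t * \1_D t)%:E| `^ r))%E.
  move=> h0 r0; rewrite integral_mkcond; apply: eq_integral => t _.
  rewrite gee0_abs ?lee_fin ?mulr_ge0 // poweR_EFin /patch indicE.
  by case: ifP => _; rewrite ?mulr1 // mulr0 powR0.
have q1p : q^-1 + p^-1 = 1 by rewrite addrC.
have h := @hoelder _ _ _ mu F G q p mF mG q0 p0 q1p.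
rewrite (restr f) ?gt_eqF // (restr g) ?gt_eqF // -!poweR_Lnorm ?gt_eqF //.
rewrite -poweRrM mulrCA divff ?gt_eqF // mulr1 -poweRM ?Lnorm_ge0 //.
have -> : (\int[mu]_(t in D) (f t * g t)%:E = 'N[mu]_1[EFin \o (F \* G)%R])%E.
  rewrite Lnorm1 [LHS]integral_mkcond; apply: eq_integral => t _ /=.
  rewrite ger0_norm ?mulr_ge0 // /patch /F /G indicE.
  by case: ifP => _; rewrite ?mulr1 // !mulr0.
apply: gt0_ler_poweR => //; first exact: ltW.
- by rewrite in_itv /= Lnorm_ge0 leey.
- by rewrite in_itv /= mule_ge0 ?Lnorm_ge0 // leey.
Qed.

(** Both sides are iterated integrals of [u t * v s] over the triangle [0 < s < t]. *)
Lemma tonelli_triangle (u v : R -> R) :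
  measurable_fun setT u -> measurable_fun setT v ->
  (forall t, 0 <= u t) -> (forall t, 0 <= v t) ->
  (\int[mu]_(t in `]0%R, +oo[) ((u t)%:E * \int[mu]_(s in `]0%R, t[) (v s)%:E) =
   \int[mu]_(s in `]0%R, +oo[) ((v s)%:E * \int[mu]_(t in `]s, +oo[) (u t)%:E))%E.
Proof.
move=> mu_ mv u0 v0.
pose T := measurableTypeR R.
pose f (z : T * T) : \bar R :=
  (if (0 < z.2) && (z.2 < z.1) then u z.1 * v z.2 else 0)%:E.
have mf : measurable_fun setT f.
  apply/measurable_EFinP; apply: measurable_fun_ifT.
  - apply: measurable_and; first exact: measurable_fun_ltr.
    exact: measurable_fun_ltr.
  - by apply: measurable_funM; exact: measurableT_comp.
  - exact: measurable_cst.
have f0 z : (0 <= f z)%E by rewrite lee_fin; case: ifP => // _; rewrite mulr_ge0.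
have := @fubini_tonelli _ _ _ _ R mu mu f mf f0.
have -> : (\int[mu]_x \int[mu]_y f (x, y) = \int[mu]_(t in `]0%R, +oo[)
   ((u t)%:E * \int[mu]_(s in `]0%R, t[) (v s)%:E))%E.
  rewrite [RHS]integral_mkcond; apply: eq_integral => t _; rewrite /patch.
  case: ifPn => [/set_mem /=|/negP h].
    rewrite in_itv /= andbT => t0.
    rewrite -ge0_integralZl ?lee_fin //.
    + rewrite [RHS]integral_mkcond; apply: eq_integral => s _.
      rewrite /f /patch /= mem_setE in_itv /=.
      by case: ifP; rewrite ?EFinM.
    + by apply/measurable_EFinP; exact: measurable_funTS.
    + by move=> s _; rewrite lee_fin.
  apply: integral0_eq => s _; rewrite /f /=; case: ifP => // /andP[s0 st].
  by case: h; apply/mem_set; rewrite /= in_itv /= (lt_trans s0).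
move=> ->; rewrite [RHS]integral_mkcond; apply: eq_integral => s _; rewrite /patch.
case: ifPn => [/set_mem /=|/negP h].
  rewrite in_itv /= andbT => s0.
  rewrite -ge0_integralZl ?lee_fin //.
  + rewrite [RHS]integral_mkcond; apply: eq_integral => t _.
    rewrite /f /patch /= mem_setE in_itv /= s0 andbT /=.
    by case: ifP => _ //; rewrite EFinM muleC.
  + by apply/measurable_EFinP; exact: measurable_funTS.
  + by move=> t _; rewrite lee_fin.
apply: integral0_eq => t _; rewrite /f /=; case: ifP => // /andP[s0 st].
by case: h; apply/mem_set; rewrite /= in_itv /= s0.
Qed.

(* Hoelder with the splitting [N = s^-b (s^b N)] for
   some [a < b < 1 - 1/p], then Tonelli. *)
Lemma hardy (p a : R) : 1 < p -> a < 1 - p^-1 ->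
  exists2 K : R, 0 <= K & forall N, measurable_fun setT N -> (forall t, 0 <= N t) ->
  (\int[mu]_(t in `]0%R, +oo[) ((t `^ ((a - 1) * p))%:E *
     (\int[mu]_(s in `]0%R, t[) (N s)%:E) `^ p) <=
   K%:E * \int[mu]_(t in `]0%R, +oo[) (t `^ (a * p) * N t `^ p)%:E)%E.
Proof.
move=> p1 ap.
have p0 : 0 < p by rewrite (lt_trans _ p1).
pose q := (1 - p^-1)^-1.
have q0 : 0 < q by rewrite invr_gt0 subr_gt0 invf_lt1.
have qV : q^-1 = 1 - p^-1 by rewrite invrK.
have pqV : p^-1 + q^-1 = 1 by rewrite qV addrC subrK.
(* Here [q] is the conjugate exponent. The inequality [b < q^-1] gives [r > 0], so [s^(- b q)] is
   integrable at 0; the inequality [a < b] gives [d > 0], so [t^(- d - 1)] is integrable at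
   infinity. *)
pose b := (a + q^-1) / 2.
have [ab bq] : a < b /\ b < q^-1 by rewrite /b qV; split; lra.
pose r := 1 - b * q.
have r0 : 0 < r by rewrite subr_gt0 -ltr_pdivlMr // mul1r.
pose d := (b - a) * p.
have d0 : 0 < d by rewrite mulr_gt0 // subr_gt0.
have pq1 : p / q = p - 1 by rewrite qV mulrBr mulr1 divff // gt_eqF.
have pE : (p - 1) * q = p by rewrite -pq1 divfK // gt_eqF.
exists (r^-1 `^ (p - 1) * d^-1); first by rewrite mulr_ge0 ?powR_ge0 // invr_ge0 ltW.
move=> N mN N0.
pose Psi s := s `^ (b * p) * N s `^ p.
have mPsi : measurable_fun setT Psi.
  apply: measurable_funM; first exact: measurable_powR.
  exact: (measurableT_comp (measurable_powR p) mN).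
have Psi0 s : 0 <= Psi s by rewrite mulr_ge0 ?powR_ge0.
have Hle t : 0 < t -> ((\int[mu]_(s in `]0%R, t[) (N s)%:E) `^ p <=
    ((r^-1 * t `^ r) `^ (p - 1))%:E * \int[mu]_(s in `]0%R, t[) (Psi s)%:E)%E.
  move=> t0.
  have -> : (\int[mu]_(s in `]0%R, t[) (N s)%:E =
      \int[mu]_(s in `]0%R, t[) (s `^ (- b) * (s `^ b * N s))%:E)%E.
    apply: eq_integral => s; rewrite mem_setE in_itv /= => /andP[s0 _].
    by rewrite mulrA -powRD ?(gt_eqF s0) ?implybT // addNr powRr0 mul1r.
  apply: (le_trans (hoelder_integral_powR _ _ _ _ _ p0 q0 pqV)) => //.
  - by apply: measurable_funM => //; exact: measurable_powR.
  - by move=> s; exact: powR_ge0.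
  - by move=> s; rewrite mulr_ge0 ?powR_ge0.
  rewrite pq1; apply: lee_pmul.
  - exact: poweR_ge0.
  - by apply: integral_ge0 => s _; rewrite lee_fin powR_ge0.
  - rewrite -poweR_EFin; apply: gt0_ler_poweR.
    + by rewrite subr_ge0 ltW.
    + by rewrite in_itv /= leey integral_ge0 // => s _; rewrite lee_fin powR_ge0.
    + by rewrite in_itv /= leey lee_fin mulr_ge0 ?powR_ge0 // invr_ge0 ltW.
    rewrite (le_trans _ (integral_powR_near0 r0 t0)) // le_eqVlt.
    apply/orP; left; apply/eqP; apply: eq_integral => s _.
    by rewrite -powRrM /r addrAC subrr add0r mulNr.
  - apply: ae_le_lower_integral => [s _|s _|]; rewrite ?lee_fin ?powR_ge0 //.
    by apply: aeW => s _; rewrite lee_fin powRM ?powR_ge0 // -powRrM.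
pose c := r^-1 `^ (p - 1).
have c0 : 0 <= c by exact: powR_ge0.
(* The exponent adds [(a - 1) * p] from the outer weight and [r * (p - 1)] from Hoelder's
   inequality. After the exchange of integrals, the tail of [u] beyond [s] is at most [c / d] times
   [s^(- d)], which turns the weight [s^(b p)] back into [s^(a p)]. *)
pose u t := c * t `^ (- d - 1).
have u0 t : 0 <= u t by rewrite mulr_ge0 // powR_ge0.
apply: (@le_trans _ _ (\int[mu]_(t in `]0%R, +oo[)
    ((u t)%:E * \int[mu]_(s in `]0%R, t[) (Psi s)%:E))%E).
  apply: ae_le_lower_integral => [t _|t _|].
  - by rewrite mule_ge0 ?lee_fin ?powR_ge0 // poweR_ge0.
  - by rewrite mule_ge0 ?lee_fin // integral_ge0 // => s _; rewrite lee_fin.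
  apply: aeW => t; rewrite /= in_itv /= andbT => t0.
  have -> : ((u t)%:E * \int[mu]_(s in `]0%R, t[) (Psi s)%:E =
      (t `^ ((a - 1) * p))%:E * (((r^-1 * t `^ r) `^ (p - 1))%:E *
        \int[mu]_(s in `]0%R, t[) (Psi s)%:E))%E.
    rewrite muleA -EFinM; congr (_%:E * _)%E.
    rewrite powRM ?powR_ge0 ?invr_ge0 ?(ltW r0) // mulrCA -powRrM; congr (_ * _).
    rewrite -powRD ?(gt_eqF t0) ?implybT //; congr (_ `^ _).
    have -> : r * (p - 1) = p - 1 - b * p.
      by rewrite /r mulrBl mul1r -mulrA (mulrC q) pE.
    by rewrite /d; ring.
  by apply: lee_pmul; rewrite ?lee_fin ?powR_ge0 ?poweR_ge0 // Hle.
rewrite tonelli_triangle //; last first.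
  by apply: measurable_funM => //; exact: measurable_powR.
apply: (@le_trans _ _ (\int[mu]_(s in `]0%R, +oo[)
    ((c * d^-1)%:E * (s `^ (a * p) * N s `^ p)%:E))%E).
  apply: ae_le_lower_integral => [s _|s _|].
  - by rewrite mule_ge0 ?lee_fin // integral_ge0 // => t _; rewrite lee_fin.
  - by rewrite mule_ge0 ?lee_fin ?mulr_ge0 ?powR_ge0 // invr_ge0 ltW.
  apply: aeW => s; rewrite /= in_itv /= andbT => s0.
  rewrite -EFinM.
  have -> : (c / d * (s `^ (a * p) * N s `^ p) = Psi s * (c * (d^-1 * s `^ (- d)))).
    have -> : a * p = b * p + - d by rewrite /d; ring.
    by rewrite powRD ?(gt_eqF s0) ?implybT // /Psi; ring.
  rewrite [leRHS]EFinM; apply: lee_pmul => //; first by rewrite lee_fin.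
    by apply: integral_ge0 => t _; rewrite lee_fin.
  under eq_integral do rewrite EFinM.
  rewrite ge0_integralZl ?lee_fin //.
  - by rewrite [leRHS]EFinM lee_pmul ?lee_fin // ?integral_ge0 ?integral_powR_neary // =>
      t _; rewrite lee_fin powR_ge0.
  - by apply/measurable_EFinP; apply: measurable_funTS; exact: measurable_powR.
  - by move=> t _; rewrite lee_fin powR_ge0.
rewrite ge0_integralZl ?lee_fin //.
- apply/measurable_EFinP; apply: measurable_funTS.
  apply: measurable_funM; first exact: measurable_powR.
  exact: (measurableT_comp (measurable_powR p) mN).
- by move=> t _; rewrite lee_fin mulr_ge0 ?powR_ge0.
- by rewrite mulr_ge0 // invr_ge0 ltW.
Qed.

End Hardy.

(** * Maximal regularity and decay of the semigroup *)

Lemma lebesgue_measure_oo (R : realType) (a b : R) : a < b ->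
  lebesgue_measure `]a, b[ = (b - a)%:E.
Proof. by move=> ab; rewrite lebesgue_measure_itv /= lte_fin ab EFinB. Qed.

Lemma lebesgue_measure_oo_lty (R : realType) (a b : R) : a < b ->
  (lebesgue_measure `]a, b[ < +oo)%E.
Proof. by move=> /lebesgue_measure_oo ->; rewrite ltry. Qed.

Lemma integral_cst_oo (R : realType) (a b : R) (c : \bar R) : a < b ->
  (\int[lebesgue_measure]_(t in `]a, b[) c = c * (b - a)%:E)%E.
Proof.
move=> ab; rewrite -(lebesgue_measure_oo ab).
exact: (integral_cst (@lebesgue_measure R) (measurable_itv _) c).
Qed.

(** * L^p bounds in terms of p-th powers *)

Section LpNorms.
Variable R : realType.
Notation mu := (@lebesgue_measure R).
Implicit Types E F : normedModType R[i].

(** Unlike the norm, its p-th power can be summed over the pieces of a partition of the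
    half-line. *)
Definition Lp_pow E (p : R) (f : R -> E) : \bar R :=
  (\int[mu]_(t in `]0%R, +oo[) (rnorm (f t) `^ p)%:E)%E.

Lemma Lp_pow_ge0 E p (f : R -> E) : (0 <= Lp_pow p f)%E.
Proof. by apply: integral_ge0 => t _; rewrite lee_fin powR_ge0. Qed.

Lemma Lp_norm_powE E p (f : R -> E) : p != 0 -> (Lp_norm p f `^ p)%E = Lp_pow p f.
Proof. by move=> p0; rewrite /Lp_norm -poweRrM mulVf // poweRe1 // Lp_pow_ge0. Qed.

Lemma Lp_norm_lty E p (f : R -> E) : p != 0 ->
  (Lp_norm p f < +oo)%E <-> (Lp_pow p f < +oo)%E.
Proof.
by move=> p0; split=> [|h]; [apply: lty_poweRy; rewrite invr_eq0|exact: poweR_lty].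
Qed.

Lemma Lp_norm_le E F p (K : R) (f : R -> E) (g : R -> F) : 0 < p -> 0 <= K ->
  (Lp_norm p g <= K%:E * Lp_norm p f)%E <->
  (Lp_pow p g <= (K `^ p)%:E * Lp_pow p f)%E.
Proof.
move=> p0 K0; have pn0 : p != 0 by rewrite gt_eqF.
have mono (x y : \bar R) (r : R) : 0 <= r -> (0 <= x)%E -> (0 <= y)%E ->
    (x <= y)%E -> (x `^ r <= y `^ r)%E.
  by move=> r0 x0 y0; apply: gt0_ler_poweR => //; rewrite in_itv /= leey andbT.
have Kf0 : (0 <= K%:E * Lp_norm p f)%E by rewrite mule_ge0 ?lee_fin // poweR_ge0.
split=> h.
  rewrite -(Lp_norm_powE g) // -(Lp_norm_powE f) // -poweR_EFin -poweRM ?poweR_ge0 //.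
  by apply: mono => //; [exact: ltW|exact: poweR_ge0].
have -> : (K%:E = (K `^ p)%:E `^ p^-1)%E.
  by rewrite poweR_EFin -powRrM divff // powRr1.
rewrite -poweRM ?Lp_pow_ge0 ?lee_fin ?powR_ge0 //.
apply: mono => //; first by rewrite invr_ge0 ltW.
- exact: Lp_pow_ge0.
- by rewrite mule_ge0 ?lee_fin ?powR_ge0 // Lp_pow_ge0.
Qed.

Lemma maximal_regularity_pow (W Z : normedModType R[i]) (k : {linear Z -> W})
    (T : R -> {linear W -> W}) (p : R) : 0 < p -> maximal_Lp_regularity k T p ->
  exists2 K : R, 0 <= K & forall f : R -> W,
    strongly_measurable `]0, +oo[ f -> (Lp_pow p f < +oo)%E ->
    exists g : R -> Z,
      [/\ {ae mu, forall t, 0 < t -> is_convolution T f t (k (g t))},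
          strongly_measurable `]0, +oo[ g & (Lp_pow p g <= K%:E * Lp_pow p f)%E].
Proof.
move=> p0 [K hK]; have pn0 : p != 0 by rewrite gt_eqF.
(* The constant in [maximal_Lp_regularity] carries no sign, whereas raising the estimate to the
   power [p] calls for a nonnegative one. *)
exists (Num.max K 0 `^ p); first exact: powR_ge0.
move=> f smf fp; have [|g [fg [smg _] gf]] := hK f.
  by split=> //; exact/Lp_norm_lty.
exists g; split=> //; apply/Lp_norm_le => //; first by rewrite le_max lexx orbT.
apply: (le_trans gf); apply: lee_wpmul2r; first exact: poweR_ge0.
by rewrite lee_fin le_max lexx.
Qed.

Lemma powR_le_root (p K a b : R) : 0 < p -> 0 <= a -> 0 <= b -> 0 <= K ->
  a `^ p <= K * b `^ p -> a <= K `^ p^-1 * b.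
Proof.
move=> p0 a0 b0 K0 h.
have -> : a = (a `^ p) `^ p^-1 by rewrite -powRrM divff ?gt_eqF // powRr1.
have -> : b = (b `^ p) `^ p^-1 by rewrite -powRrM divff ?gt_eqF // powRr1.
rewrite -powRM ?powR_ge0 //; apply: ge0_ler_powR => //.
- by rewrite invr_ge0 ltW.
- by rewrite nnegrE powR_ge0.
- by rewrite nnegrE mulr_ge0 ?powR_ge0.
Qed.

End LpNorms.

(** * Orbits of the semigroup in the graph norm *)

Section Semigroup.
Variables (R : realType) (W Z : normedModType R[i]) (k : {linear Z -> W}).
Variables (A : set (W * W)) (T : R -> {linear W -> W}).
Notation mu := (@lebesgue_measure R).
Hypothesis opA : operator A.
Hypothesis hk : is_graph_domain A k.
Hypothesis hT : semigroup T.
Hypothesis T_cts : forall x (t : R), 0 < t -> T s x @[s --> t] --> T t x.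
Hypothesis T_near0 : exists M : R, forall t x, 0 < t <= 1 -> rnorm (T t x) <= M * rnorm x.
Hypothesis T_A : forall t x y, 0 <= t -> A (x, y) -> A (T t x, T t y).

Lemma graph_value z : exists v, A (k z, v).
Proof. by have [e _] := hk; have : op_dom A (k z) by rewrite -e; exists z. Qed.

Lemma graph_rnorm z v : A (k z, v) -> rnorm z = rnorm (k z) + rnorm v.
Proof. by have [_ h] := hk => /h e; rewrite /rnorm e raddfD. Qed.

Lemma graph_rnorm_ge z : rnorm (k z) <= rnorm z.
Proof.
by have [v /graph_rnorm ->] := graph_value z; rewrite lerDl rnorm_ge0.
Qed.

(** [A] is single-valued, so a difference sent to 0 by [k] also has [A]-value 0, hence graph norm
    0. *)
Lemma graph_injective : injective k.
Proof.
move=> z z' e; have [v Av] := graph_value (z - z').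
apply/eqP; rewrite -subr_eq0; apply/eqP/rnorm0_eq0.
rewrite (graph_rnorm Av); move: Av; rewrite linearB e subrr /= => Av.
have [_ _ /(_ _ Av) ->] := opA; by rewrite !rnorm0 addr0.
Qed.

(** [T t] commutes with [A], so its bound on [W] holds for both terms of the graph norm with the
    same constant. *)
Lemma semigroup_graph (M t : R) z : 0 <= t -> (forall x, rnorm (T t x) <= M * rnorm x) ->
  exists2 z', T t (k z) = k z' & rnorm z' <= M * rnorm z.
Proof.
move=> t0 TM; have [v Av] := graph_value z.
have Av' := T_A t0 Av.
have : (range k) (T t (k z)) by have [-> _] := hk; exists (T t v).
move=> [z' _ e]; exists z' => //; rewrite -e in Av'.
rewrite (graph_rnorm Av) (graph_rnorm Av') e mulrDr.
by rewrite lerD.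
Qed.

Lemma semigroup0 x : T 0 x = x.
Proof. by have [_ ->] := hT. Qed.

Lemma semigroupD s t x : 0 <= s -> 0 <= t -> T (s + t) x = T s (T t x).
Proof. by move=> s0 t0; have [_ _ ->] := hT. Qed.

(** The positivity of [phi] on [D] matters: orbits are known to be continuous only at positive
    times. *)
Lemma orbit_sm (phi : R -> R) (D : set R) x : measurable_fun setT phi ->
  (forall t, 0 <= phi t) -> (forall t, D t -> 0 < phi t) ->
  strongly_measurable D (fun t => T (phi t) x).
Proof.
move=> mphi phi0 Dphi.
apply: (@sm_action _ _ _ phi (fun h _ => T h x) D (fun=> x)) => //; last exact: sm_cst.
move=> t h s Dt _ h_phi _.
have := T_cts (x := x) (Dphi _ Dt).
exact: (cvg_comp _ _ h_phi).
Qed.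

(** By the semigroup law the integrand equals the constant [T s x] on (0, min(s, c)) and vanishes
    afterwards. *)
Lemma convolution_truncated_orbit (c s : R) x : 0 < c -> 0 < s ->
  is_convolution T (fun t => if t \in [set` `]0, c[] then T t x else 0) s
    ((Num.min s c)%:C%C *: T s x).
Proof.
move=> c0 s0; have m0 : 0 < Num.min s c by rewrite lt_min s0.
have fin (y : R) : 0 < y -> (mu `]0%R, y[ < +oo)%E by exact: lebesgue_measure_oo_lty.
have /(bochner_restrict (measurable_itv _) (fin _ s0) (measurable_itv _)) h :=
  bochner_cst (measurable_itv _) (fin _ m0) (T s x).
rewrite /is_convolution; move: h; rewrite lebesgue_measure_oo //= subr0 => h.
apply: bochner_ae_eq (h _) => //.
- exact: fin.
- apply: aeW => t; rewrite /= !in_itv /= => /andP[t0 ts].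
  rewrite !mem_setE !in_itv /= t0 /= lt_min ts /=.
  case: ifP => _; last by rewrite linear0.
  by rewrite -semigroupD ?subrK // ?subr_ge0 ltW.
- move=> t; rewrite /= !in_itv /= => /andP[-> ].
  by rewrite lt_min => /andP[].
Qed.

Variables (p K : R).
Hypotheses (p0 : 0 < p) (K0 : 0 <= K).
Hypothesis hmax : forall f : R -> W,
  strongly_measurable `]0, +oo[ f -> (Lp_pow p f < +oo)%E ->
  exists g : R -> Z,
    [/\ {ae mu, forall t, 0 < t -> is_convolution T f t (k (g t))},
        strongly_measurable `]0, +oo[ g & (Lp_pow p g <= K%:E * Lp_pow p f)%E].

(* Maximal regularity is applied to [f = 1_(0,c) T(.) x], whose convolution
   with the semigroup is [s |-> min(s, c) T(s) x]. *)
Lemma orbit_in_domain (c r t N N' : R) x : 0 < c -> 0 < r -> r < t -> 0 < N' ->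
  (forall s, 0 < s < c -> rnorm (T s x) <= N) ->
  (forall s y, 0 <= s <= t - r -> rnorm (T s y) <= N' * rnorm y) ->
  0 <= N ->
  exists2 z, T t x = k z &
    (rnorm z * Num.min r c / N') `^ p * (t - r) <= K * (c * N `^ p).
Proof.
move=> c0 r0 rt N'0 TN TN' N0.
have t0 : 0 < t by exact: lt_trans rt.
pose f s := if s \in [set` `]0, c[] then T s x else 0.
have smf : strongly_measurable `]0, +oo[ f.
  apply: sm_if; [exact: measurable_itv| |exact: sm_cst].
  (* The time argument has to be nonnegative on the whole line; the maximum with 0 changes nothing
     on the half-line. *)
  apply: (sm_ae_eq (f := fun t => T (Num.max t 0) x)).
    apply: aeW => s [/=]; rewrite in_itv /= andbT => s0 _.
    by rewrite max_l // ltW.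
  apply: orbit_sm => [|s|s [/=]].
  - exact: measurable_maxr.
  - by rewrite le_max lexx orbT.
  - by rewrite in_itv /= andbT lt_max => -> _.
have fp : (Lp_pow p f <= (c * N `^ p)%:E)%E.
  apply: (@le_trans _ _ (\int[mu]_(s in `]0%R, c[) (N `^ p)%:E)%E).
    rewrite [leRHS]integral_mkcond [leLHS]integral_mkcond.
    apply: ae_le_lower_integral => [s _|s _|].
    - by rewrite /patch; case: ifP => // _; rewrite lee_fin powR_ge0.
    - by rewrite /patch; case: ifP => // _; rewrite lee_fin powR_ge0.
    apply: aeW => s _; rewrite /patch /f.
    case: ifPn => _; last by case: ifP => // _; rewrite lee_fin powR_ge0.
    case: ifPn => [/set_mem|_]; last by rewrite rnorm0 powR0 ?gt_eqF.
    rewrite /= in_itv => hs; rewrite lee_fin; apply: ge0_ler_powR.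
    - exact: ltW.
    - by rewrite nnegrE rnorm_ge0.
    - by rewrite nnegrE.
    - exact: TN.
  by rewrite integral_cst_oo // subr0 -EFinM lee_fin mulrC.
have [g [gconv _ gp]] := hmax smf (le_lt_trans fp (ltry _)).
have good : {ae mu, forall s, r < s < t -> k (g s) = (Num.min s c)%:C%C *: T s x}.
  apply: filterS gconv => s h /andP[rs _].
  have s0 : 0 < s by exact: lt_trans rs.
  have muf : (mu `]0%R, s[ < +oo)%E by exact: lebesgue_measure_oo_lty.
  apply: (bochner_unique (measurable_itv _) muf (h s0)).
  exact: convolution_truncated_orbit.
(* Since [T t x = T (t - s) (T s x)] and [T s x] is [k (g s)] divided by [min(s, c)], the vector
   [T t x] lies in the domain with graph norm at most [N' / min(s, c)] times that of [g s]; on (r,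
   t) one has [min(s, c) >= min(r, c)]. *)
have zE s : r < s < t -> k (g s) = (Num.min s c)%:C%C *: T s x ->
    exists2 z, T t x = k z & rnorm z * Num.min r c / N' <= rnorm (g s).
  move=> /andP[rs st] e.
  have s0 : 0 < s by exact: lt_trans rs.
  have m0 : 0 < Num.min s c by rewrite lt_min s0.
  have ts : 0 <= t - s by rewrite subr_ge0 ltW.
  have TsN y : rnorm (T (t - s) y) <= N' * rnorm y.
    by apply: TN'; rewrite ts lerD2l lerN2 ltW.
  have [z ez zN] := semigroup_graph (((Num.min s c)^-1)%:C%C *: g s) ts TsN.
  exists z.
    rewrite -ez linearZ /= e scalerA -rmorphM mulVf ?gt_eqF // scale1r.
    by rewrite -semigroupD ?subrK // ltW.
  rewrite ler_pdivrMr // (mulrC (rnorm (g s))).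
  rewrite rnormZ ger0_norm ?invr_ge0 ?(ltW m0) // in zN.
  rewrite mulrCA mulrC ler_pdivlMr // in zN.
  apply: (@le_trans _ _ (rnorm z * Num.min s c)).
    by rewrite ler_wpM2l ?rnorm_ge0 // le_min !ge_min (ltW rs) lexx orbT.
  exact: zN.
(* A single good [s] suffices for membership in the domain; it exists because (r, t) is not a null
   set. *)
have [s0 hs0 es0] : exists2 s, r < s < t & k (g s) = (Num.min s c)%:C%C *: T s x.
  apply: contrapT => hn; have [N1 [mN1 N10 sN1]] := good.
  have : (mu `]r, t[ <= mu N1)%E.
    apply: le_measure; rewrite ?inE //.
    move=> s; rewrite /= in_itv /= => hs; apply: sN1 => /= /(_ hs) e.
    by apply: hn; exists s.
  by rewrite N10 lebesgue_measure_oo // lee_fin subr_le0 leNgt rt.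
have [z ez _] := zE _ hs0 es0; exists z => //.
(* By injectivity of [k], all good [s] produce the same [z]. The lower bound for [g] is thus
   constant on almost all of (r, t), and integrating its p-th power yields the factor [t - r]. *)
have zg : {ae mu, forall s, r < s < t -> rnorm z * Num.min r c / N' <= rnorm (g s)}.
  apply: filterS good => s /[swap] hs /(_ hs) /(zE _ hs) [z' ez'].
  by rewrite (graph_injective (etrans (esym ez) ez')).
rewrite -lee_fin; apply: (@le_trans _ _ (K%:E * Lp_pow p f)%E); last first.
  by rewrite EFinM lee_wpmul2l // lee_fin.
apply: le_trans gp; rewrite EFinM -integral_cst_oo //.
rewrite /Lp_pow [leRHS]integral_mkcond [leLHS]integral_mkcond.
apply: ae_le_lower_integral => [s _|s _|].
- by rewrite /patch; case: ifP => // _; rewrite lee_fin powR_ge0.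
- by rewrite /patch; case: ifP => // _; rewrite lee_fin powR_ge0.
apply: filterS zg => s h _; rewrite /patch.
case: ifPn => [/set_mem /=|_]; last by case: ifP => // _; rewrite lee_fin powR_ge0.
rewrite in_itv /= => hs; rewrite mem_setE in_itv /= andbT.
have /andP[rs _] := hs; rewrite (lt_trans r0 rs) lee_fin ge0_ler_powR ?(ltW p0) ?h //.
- by rewrite nnegrE divr_ge0 ?(ltW N'0) // mulr_ge0 ?rnorm_ge0 // le_min !ltW.
- by rewrite nnegrE rnorm_ge0.
Qed.

(** Up to time 2, the bound near 0 is used twice. Beyond it, [orbit_in_domain] with [c = 1] and
    [r = t - 1] involves the semigroup only at times at most 1 in its hypotheses, so the resulting
    bound does not depend on [t]; the graph norm dominates the norm of [W]. *)
Lemma semigroup_bounded : exists2 M, 0 < M &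
  forall t x, 0 <= t -> rnorm (T t x) <= M * rnorm x.
Proof.
have [M0 hM0] := T_near0.
pose M1 := Num.max M0 1.
have M1_ge1 : 1 <= M1 by rewrite le_max lexx orbT.
have M1_gt0 : 0 < M1 by exact: lt_le_trans M1_ge1.
have hM1 t x : 0 <= t <= 1 -> rnorm (T t x) <= M1 * rnorm x.
  move=> /andP[]; rewrite le_eqVlt => /predU1P[<- _|t0 t1].
    by rewrite semigroup0 ler_peMl ?rnorm_ge0.
  rewrite (le_trans (hM0 _ _ _)) ?t0 // ler_wpM2r ?rnorm_ge0 //.
  by rewrite le_max lexx.
pose M := M1 * M1 * Num.max (K `^ p^-1) 1.
have M_ge : M1 * M1 <= M.
  by rewrite ler_peMr ?mulr_ge0 ?(ltW M1_gt0) // le_max lexx orbT.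
exists M; first by rewrite (lt_le_trans _ M_ge) // mulr_gt0.
move=> t x t0; have [t2|t2] := leP t 2.
  apply: (@le_trans _ _ (M1 * M1 * rnorm x)); last by rewrite ler_wpM2r ?rnorm_ge0.
  have t20 : 0 <= t / 2 <= 1 by rewrite divr_ge0 //= ler_pdivrMr // mul1r.
  have /andP[t20' _] := t20.
  rewrite [in T t x](splitr t) semigroupD // (le_trans (hM1 _ _ t20)) //.
  by rewrite -mulrA ler_pM2l // hM1.
have [|||||||z -> hz] := @orbit_in_domain 1 (t - 1) t (M1 * rnorm x) M1 x.
- by [].
- by rewrite subr_gt0 (lt_trans _ t2) // ltr1n.
- by rewrite ltrBlDr ltrDl.
- by [].
- by move=> s /andP[s0 s1]; rewrite hM1 // !ltW.
- by move=> s y; rewrite opprB addrCA subrr addr0 => ?; exact: hM1.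
- by rewrite mulr_ge0 ?rnorm_ge0 // ltW.
apply: (le_trans (graph_rnorm_ge z)).
rewrite opprB addrCA subrr addr0 mulr1 mul1r min_r in hz; last by rewrite lerBrDr ltW.
rewrite mulr1 in hz.
have := powR_le_root p0 _ _ K0 hz.
rewrite ler_pdivrMr // => h.
apply: (le_trans (h _ _)).
- by rewrite divr_ge0 ?rnorm_ge0 // ltW.
- by rewrite mulr_ge0 ?rnorm_ge0 // ltW.
have -> : K `^ p^-1 * (M1 * rnorm x) * M1 = M1 * M1 * K `^ p^-1 * rnorm x by ring.
by rewrite ler_wpM2r ?rnorm_ge0 // ler_wpM2l ?mulr_ge0 ?(ltW M1_gt0) // le_max lexx.
Qed.

(** With [c = t] and [r = t / 2], the lengths of (0, c) and (r, t) are both proportional to [t] and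
    cancel up to the factor 2 next to [K]. The remaining factor [min(r, c) = t / 2] gives the
    decay. *)
Lemma semigroup_decay : exists2 L, 0 <= L & forall t x, 0 < t ->
  exists2 z, T t x = k z & rnorm z <= L / t * rnorm x.
Proof.
have [M M0 hM] := semigroup_bounded.
exists (2 * M * ((K * 2) `^ p^-1 * M)).
  by rewrite !mulr_ge0 ?powR_ge0 // ltW.
move=> t x t0.
have t20 : 0 < t / 2 by rewrite divr_gt0.
have tE : t - t / 2 = t / 2 by rewrite {1}(splitr t) addrK.
have [|||||||z -> hz] := @orbit_in_domain t (t / 2) t (M * rnorm x) M x.
- by [].
- by [].
- by rewrite ltr_pdivrMr // ltr_pMr // ltr1n.
- by [].
- by move=> s /andP[s0 _]; rewrite hM // ltW.
- by move=> s y /andP[s0 _]; rewrite hM.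
- by rewrite mulr_ge0 ?rnorm_ge0 // ltW.
exists z => //; rewrite tE min_l in hz; last first.
  by rewrite ler_pdivrMr // ler_pMr // ler1n.
have {}hz : (rnorm z * (t / 2) / M) `^ p <= K * 2 * (M * rnorm x) `^ p.
  rewrite -(ler_pM2r t20) (le_trans hz) // le_eqVlt; apply/orP; left.
  by apply/eqP; field.
have K20 : 0 <= K * 2 by rewrite mulr_ge0.
have := powR_le_root p0 _ _ K20 hz.
rewrite ler_pdivrMr // -ler_pdivlMr // => h.
apply: (le_trans (h _ _)).
- by rewrite divr_ge0 ?(ltW M0) // mulr_ge0 ?rnorm_ge0 // ltW.
- by rewrite mulr_ge0 ?rnorm_ge0 // ltW.
rewrite le_eqVlt; apply/orP; left; apply/eqP; field.
by rewrite gt_eqF.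
Qed.

(** The vector [T (t / 2) x] is in the domain, with [A]-value [v]. For [s > t / 2] the [A]-value of
    [T s x] is [T (s - t / 2) v], again an orbit at positive times, so both terms of the graph norm
    are continuous at [t]. *)
Lemma orbit_graph_cvg (z : R -> Z) x (t : R) : 0 < t ->
  (forall s, 0 < s -> T s x = k (z s)) -> z s @[s --> t] --> z t.
Proof.
move=> t0 hz.
have t20 : 0 < t / 2 by rewrite divr_gt0.
have t2t : t / 2 < t by rewrite ltr_pdivrMr // ltr_pMr // ltr1n.
have [v Av] := graph_value (z (t / 2)).
have AT s : t / 2 < s -> A (k (z s), T (s - t / 2) v).
  move=> ts; have s0 : 0 < s by exact: lt_trans ts.
  have ts0 : 0 <= s - t / 2 by rewrite subr_ge0 ltW.
  have := T_A ts0 Av; rewrite -hz // -semigroupD ?(ltW t20) //.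
  by rewrite subrK hz.
have near_s : \forall s \near t, t / 2 < s by exact: lt_nbhsr.
apply: (@cvg_rnorm_le _ _ _ _ _ _ _ (fun s => rnorm (T t x - T s x) +
   rnorm (T (t - t / 2) v - T (s - t / 2) v))).
  apply: filterS near_s => s ts; have s0 : 0 < s by exact: lt_trans ts.
  have [_ /(_ (-1) _ _ (AT s ts) (AT t t2t)) h _] := opA.
  rewrite !scaleN1r /= in h.
  rewrite (hz _ t0) (hz _ s0) -linearB /= -[X in _ + rnorm X]addrC.
  rewrite (@graph_rnorm (z t - z s) (- T (s - t / 2) v + T (t - t / 2) v)) //.
  by rewrite linearB /= addrC.
rewrite -[X in _ --> X]addr0; apply: cvgD; apply/cvg_rnorm; first exact: T_cts.
have tt : 0 < t - t / 2 by rewrite subr_gt0.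
have := T_cts (x := v) tt; apply: cvg_comp.
by apply: cvgB; [exact: cvg_id|exact: cvg_cst].
Qed.

Lemma orbit_graph_sm (z : R -> Z) (phi : R -> R) (D : set R) x : measurable_fun setT phi ->
  (forall t, 0 <= phi t) -> (forall t, D t -> 0 < phi t) ->
  (forall s, 0 < s -> T s x = k (z s)) ->
  strongly_measurable D (z \o phi).
Proof.
move=> mphi phi0 Dphi hz.
apply: (@sm_action _ _ _ phi (fun h _ => z h) D (fun=> 0 : W)) => //; last exact: sm_cst.
move=> t h s Dt _ h_phi _.
exact: (cvg_comp _ _ h_phi (orbit_graph_cvg (Dphi _ Dt) hz)).
Qed.

(** Time and vector are approximated simultaneously: continuity of orbits handles the time, and the
    uniform bound [M] handles the vector. *)
Lemma convolution_sm (M t : R) (f : R -> W) : 0 <= M ->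
  (forall t x, 0 <= t -> rnorm (T t x) <= M * rnorm x) ->
  strongly_measurable `]0, t[ f ->
  strongly_measurable `]0, t[ (fun s => T (t - s) (f s)).
Proof.
move=> M0 hM smf.
apply: (sm_ae_eq (f := fun s => T (Num.max (t - s) 0) (f s))).
  apply: aeW => s /=; rewrite in_itv /= => /andP[_ st].
  by rewrite max_l // subr_ge0 ltW.
apply: (@sm_action _ _ _ (fun s => Num.max (t - s) 0) (fun h x => T h x)) => //.
- by apply: measurable_maxr => //; exact: measurable_funB.
- by move=> s; rewrite le_max lexx orbT.
move=> s h x; rewrite /= in_itv /= => /andP[_ st] h0 h_t x_f.
have ts0 : 0 < Num.max (t - s) 0 by rewrite lt_max subr_gt0 st.
apply: (@cvg_rnorm_le _ _ _ _ _ _ _ (fun n => rnorm (T (Num.max (t - s) 0) (f s) - T (h n) (f s)) +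
   M * rnorm (f s - x n))).
  apply: nearW => n; have /andP[hn0 _] := h0 n.
  rewrite (le_trans (rdist_triangle (T (h n) (f s)) _ _)) // lerD2l.
  by rewrite -linearB hM.
rewrite -[X in _ --> X]addr0; apply: cvgD.
  by apply/cvg_rnorm; exact: (cvg_comp _ _ h_t (T_cts (x := f s) ts0)).
by rewrite -(mulr0 M); apply: cvgMl_tmp; apply/cvg_rnorm.
Qed.

End Semigroup.

(** * Weighted maximal regularity *)

Section Partition.
Variable R : realType.
Notation mu := (@lebesgue_measure R).

(** The logarithms of [t] and [c] differ by at most 2, so those of the powers differ by at most
    [2 * |e|]. *)
Lemma powR_ratio (e c t : R) : 0 < c -> c <= t <= expR 2 * c ->
  t `^ e <= expR (2 * `|e|) * c `^ e /\ c `^ e <= expR (2 * `|e|) * t `^ e.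
Proof.
move=> c0 /andP[ct tc]; have t0 : 0 < t by exact: lt_le_trans ct.
have h1 : 0 <= ln t - ln c by rewrite subr_ge0 ler_ln ?posrE.
have h2 : ln t - ln c <= 2.
  by rewrite lerBlDr -[2]expRK -lnM ?posrE ?expR_gt0 // ler_ln ?posrE ?mulr_gt0 ?expR_gt0.
have h3 : `|e * (ln t - ln c)| <= 2 * `|e|.
  by rewrite normrM (ger0_norm h1) mulrC ler_wpM2r.
move: h3; rewrite ler_norml lerNl -mulrN opprB !mulrBr => /andP[h3 h4].
by split; rewrite /powR !gt_eqF // -expRD ler_expR -lerBlDr.
Qed.

(* With [n] encoding an integer [m], [c n = e^(m-1)], the fiber [q = n] is
   [[e^m, e^(m+1))] and the fiber [q' = n] is [[e^(m-1), e^m)].  The last clause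
   says that the points of [[c (q t), t)] lie in one of the two fibers at [q t]. *)
Lemma log_partition : exists (q q' : R -> nat) (c : nat -> R),
  [/\ (forall n, measurable (q @^-1` [set n])) /\
      (forall n, measurable (q' @^-1` [set n])),
      forall n, 0 < c n,
      forall t, 0 < t -> 2 * c (q t) <= t <= expR 2 * c (q t),
      forall t, 0 < t -> c (q' t) <= t <= expR 2 * c (q' t)
    & forall s t, 0 < s -> s < t -> c (q t) <= s -> q s = q t \/ q' s = q t].
Proof.
(* [pickle] codes integers by natural numbers, so that series over [nat] can be used. The default 0
   in [c] is met only at numbers coding no integer, whose fibers are empty. *)
pose q (t : R) := pickle (Num.floor (ln t)).
pose q' (t : R) := pickle (Num.floor (ln t + 1)).
pose c n : R := expR ((odflt 0 (unpickle n))%:~R - 1).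
have mfl (h : R -> R) n : measurable_fun setT h ->
    measurable ((fun t => pickle (Num.floor (h t))) @^-1` [set n]).
  move=> mh; pose I := [set x : R | pickle (Num.floor x) = n].
  have mI : measurable I.
    have [[m mn]|hn] := pselect (exists m : int, pickle m = n); last first.
      rewrite (_ : I = set0) //; apply/seteqP; split=> // x hx.
      by apply: hn; exists (Num.floor x).
    rewrite (_ : I = `[m%:~R, (m + 1)%:~R[%classic) //.
    apply/seteqP; split=> x; rewrite /I /= in_itv /=.
      move=> hx; have <- : Num.floor x = m.
        by apply: (pcan_inj (@pickleK int)); rewrite hx mn.
      by rewrite floor_le_tmp floorD1_gt.
    by move=> /floor_def ->.
  by rewrite -[X in measurable X]setTI; exact: (mh measurableT I mI).
have lnE (t : R) : 0 < t -> t = expR (ln t) by move=> t0; rewrite lnK ?posrE.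
have qP (t : R) : (Num.floor (ln t))%:~R <= ln t < (Num.floor (ln t))%:~R + 1.
  by rewrite floor_le_tmp -[1 in X in _ && X]/(1%:~R) -intrD floorD1_gt.
have q'P (t : R) : (Num.floor (ln t + 1))%:~R <= ln t + 1 < (Num.floor (ln t + 1))%:~R + 1.
  by rewrite floor_le_tmp -[1 in X in _ && (_ < X)]/(1%:~R) -intrD floorD1_gt.
exists q, q', c; split.
- split=> n; apply: mfl; first exact: measurable_ln.
  by apply: measurable_funD => //; exact: measurable_ln.
- by move=> n; exact: expR_gt0.
- move=> t t0; rewrite /c /q pickleK /=; have /andP[h1 h2] := qP t.
  apply/andP; split.
    (* The factor 2 comes from [2 <= e], an instance of [1 + x <= expR x]; it later gives
       [t - c >= t / 2]. *)
    apply: (@le_trans _ _ (expR 1 * expR ((Num.floor (ln t))%:~R - 1))).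
      by rewrite ler_wpM2r ?expR_ge0 // (le_trans _ (expR_ge1Dx _)).
    by rewrite -expRD addrC subrK {2}(lnE t t0) ler_expR.
  by rewrite -expRD {1}(lnE t t0) ler_expR; lra.
- move=> t t0; rewrite /c /q' pickleK /=; have /andP[h1 h2] := q'P t.
  apply/andP; split; first by rewrite {2}(lnE t t0) ler_expR; lra.
  by rewrite -expRD {1}(lnE t t0) ler_expR; lra.
move=> s t s0 st; rewrite /c /q /q' pickleK /= {1}(lnE s s0) ler_expR => cs.
have lst : ln s < ln t by rewrite ltr_ln ?posrE // (lt_trans s0).
have /andP[h1 h2] := qP t.
have [ms|ms] := leP (Num.floor (ln t))%:~R (ln s).
  left; congr pickle; apply: floor_def; rewrite ms intrD /=; lra.
right; congr pickle; apply: floor_def; rewrite intrD /=; lra.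
Qed.

Lemma integral_fibers (q : R -> nat) (D : set R) (f : R -> \bar R) :
  (forall n, measurable (q @^-1` [set n])) -> measurable D ->
  measurable_fun D f -> (forall t, D t -> 0 <= f t)%E ->
  (\int[mu]_(t in D) f t = \sum_(n <oo) \int[mu]_(t in D `&` q @^-1` [set n]) f t)%E.
Proof.
move=> mq mD mf f0; rewrite -ge0_integral_bigcup //.
- congr (integral _ _ _); apply/seteqP; split=> [t Dt|t [n _ []] //].
  by exists (q t).
- by move=> n; exact: (measurableI _ _ mD (mq n)).
- apply: measurable_funS mf => // t [n _ []] //.
- by move=> t [n _ [Dt _]]; exact: f0.
- by move=> n m _ _ [t [[_ /= <-] [_ /= <-]]].
Qed.

Lemma measurable_glue (q : R -> nat) (g : nat -> R -> R) :
  (forall n, measurable (q @^-1` [set n])) -> (forall n, measurable_fun setT (g n)) ->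
  measurable_fun setT (fun t => g (q t) t).
Proof.
move=> mq mg _ B mB; rewrite setTI.
rewrite (_ : _ @^-1` B = \bigcup_n (q @^-1` [set n] `&` g n @^-1` B)).
  apply: bigcupT_measurable => n; apply: measurableI => //.
  by rewrite -[X in measurable X]setTI; exact: mg.
by apply/seteqP; split=> [t Bt|t [n _ [/= <-]] //]; exists (q t).
Qed.

Lemma sm_glue (E : normedModType R[i]) (q : R -> nat) (D : set R) (g : nat -> R -> E) :
  (forall n, measurable (q @^-1` [set n])) ->
  (forall n, strongly_measurable (D `&` q @^-1` [set n]) (g n)) ->
  strongly_measurable D (fun t => g (q t) t).
Proof.
move=> mq /choice [s hs].
(* [r m j] glues the m-th approximants on the fibers of index below [j]. The diagonal [r m m] has
   finite range and equals [s (q t) m t] as soon as [m > q t]. *)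
pose r m := fix r j t := if j is j'.+1 then
  if t \in q @^-1` [set j'] then s j' m t else r j' t else 0 :> E.
have rE m j t : r m j t = if (q t < j)%N then s (q t) m t else 0.
  elim: j => //= j ->; rewrite ltnS [in RHS]leq_eqVlt.
  case: ifPn => [/set_mem /= ->|/negP h]; first by rewrite eqxx.
  by case: eqP => // e; case: h; apply/mem_set.
have hr m j : simple_fun (r m j).
  elim: j => [|j hj]; first exact: fin_fun_cst.
  exact: (fin_fun_comp (fun x : bool * (E * E) => if x.1 then x.2.1 else x.2.2)
    (fin_fun_pair (fin_fun_mem (mq j)) (fin_fun_pair ((hs j).1 m) hj))).
exists (fun m => r m m); split=> [m|]; first exact: hr.
have : {ae mu, forall t n, (D `&` q @^-1` [set n]) t -> s n m t @[m --> \oo] --> g n t}.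
  by apply/ae_foralln => n; case: (hs n).
apply: filterS => t /(_ (q t)) h Dt.
apply: (cvg_trans _ (h _)) => //; apply: near_eq_cvg.
by exists (q t).+1 => // m /= qm; rewrite rE qm.
Qed.

End Partition.

Section WeightedRegularity.
Variable R : realType.
Notation mu := (@lebesgue_measure R).

Lemma integral_EFinZl (B : set R) (b : R) (g : R -> R) : measurable B ->
  measurable_fun setT g -> (forall t, 0 <= g t) -> 0 <= b ->
  (\int[mu]_(t in B) (b * g t)%:E = b%:E * \int[mu]_(t in B) (g t)%:E)%E.
Proof.
move=> mB mg g0 b0; under eq_integral do rewrite EFinM.
rewrite ge0_integralZl ?lee_fin //; last by move=> t _; rewrite lee_fin.
by apply/measurable_EFinP; exact: measurable_funTS.
Qed.

Lemma powR_add_le (p x y : R) : 0 <= p -> 0 <= x -> 0 <= y ->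
  (x + y) `^ p <= 2 `^ p * (x `^ p + y `^ p).
Proof.
move=> p0; wlog xy : x y / x <= y.
  move=> h x0 y0; have [xy|/ltW yx] := leP x y; first exact: h.
  by rewrite addrC [x `^ p + _]addrC; exact: h.
move=> x0 y0; apply: (@le_trans _ _ ((2 * y) `^ p)).
  by apply: ge0_ler_powR; rewrite ?nnegrE ?addr_ge0 ?mulr_ge0 // mulr_natl mulr2n lerD2r.
by rewrite powRM // ler_wpM2l ?powR_ge0 // lerDr powR_ge0.
Qed.

(** Hardy's inequality rules out an infinite integral over (0, x): the integrals over (0, t) would
    be infinite for all [t > x], making the left-hand side infinite while the right-hand side is
    finite. *)
Lemma weight_locally_integrable (p a : R) (N : R -> R) : 1 < p -> a < 1 - p^-1 ->
  measurable_fun setT N -> (forall t, 0 <= N t) ->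
  (\int[mu]_(t in `]0%R, +oo[) (t `^ (a * p) * N t `^ p)%:E < +oo)%E ->
  forall x, 0 < x -> (\int[mu]_(s in `]0%R, x[) (N s)%:E < +oo)%E.
Proof.
move=> p1 ap mN N0 J x x0; have [Ch Ch0 /(_ N mN N0) hle] := hardy p1 ap.
have p0 : 0 < p by rewrite (lt_trans _ p1).
rewrite ltey; apply/eqP => Hx.
have mono t : x < t -> (\int[mu]_(s in `]0%R, t[) (N s)%:E = +oo)%E.
  move=> xt; apply/eqP; rewrite -leye_eq -Hx; apply: ge0_subset_integral => //.
  - by apply/measurable_EFinP; exact: measurable_funTS.
  - by move=> s _; rewrite lee_fin.
  by apply: subset_itvl; rewrite bnd_simp ltW.
have : (+oo * ((x + 1) - x)%:E <= Ch%:E * \int[mu]_(t in `]0%R, +oo[)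
    (t `^ (a * p) * N t `^ p)%:E)%E.
  apply: le_trans hle; rewrite -integral_cst_oo ?ltrDl //.
  rewrite [leRHS]integral_mkcond [leLHS]integral_mkcond.
  have pos t : (0 <= (t `^ ((a - 1) * p))%:E * (\int[mu]_(s in `]0%R, t[) (N s)%:E) `^ p)%E.
    by rewrite mule_ge0 ?lee_fin ?powR_ge0 // poweR_ge0.
  apply: ae_le_lower_integral => [t _|t _|]; rewrite /patch; try by case: ifP.
  apply: aeW => t _; case: ifPn => [/set_mem /=|_]; last by case: ifP.
  rewrite in_itv /= => /andP[xt _]; rewrite mem_setE in_itv /= andbT (lt_trans x0 xt).
  rewrite (mono t xt) (@eqy_poweR _ _ p) // gt0_muley // lte_fin powR_gt0 //.
  exact: lt_trans xt.
rewrite addrAC subrr add0r mule1 leye_eq => /eqP e.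
by have : (+oo < +oo :> \bar R)%E; [rewrite -{1}e lte_mul_pinfty ?lee_fin|rewrite ltxx].
Qed.

End WeightedRegularity.

Section Weighted.
Variables (R : realType) (W : completeNormedModType R[i]) (Z : normedModType R[i]).
Variables (k : {linear Z -> W}) (A : set (W * W)) (T : R -> {linear W -> W}).
Notation mu := (@lebesgue_measure R).
Hypothesis opA : operator A.
Hypothesis hk : is_graph_domain A k.
Hypothesis hT : semigroup T.
Hypothesis T_cts : forall x (t : R), 0 < t -> T s x @[s --> t] --> T t x.
Hypothesis T_near0 : exists M : R, forall t x, 0 < t <= 1 -> rnorm (T t x) <= M * rnorm x.
Hypothesis T_A : forall t x y, 0 <= t -> A (x, y) -> A (T t x, T t y).

(* [f1] is the part of [f] living on [[c, t)]; the rest is carried by [v]. *)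
Lemma convolution_split (c t : R) (f f1 : R -> W) (v : W) (G z : Z) :
  0 < c -> c < t ->
  is_bochner_integral `]0, c[ (fun s => T (c - s) (f s)) v ->
  T (t - c) v = k z ->
  (forall s, 0 < s < t -> f1 s = if s < c then 0 else f s) ->
  is_convolution T f1 t (k G) -> is_convolution T f t (k (G + z)).
Proof.
move=> c0 ct hv ez hf1 hG.
have t0 : 0 < t by exact: lt_trans ct.
have muc : (mu `]0%R, c[ < +oo)%E by exact: lebesgue_measure_oo_lty.
have mut : (mu `]0%R, t[ < +oo)%E by exact: lebesgue_measure_oo_lty.
have tc0 : 0 <= t - c by rewrite subr_ge0 ltW.
have cT : continuous (T (t - c)) by have [h _ _] := hT; exact: h.
have := bochner_linear (measurable_itv _) muc cT hv.
have sub : `]0, c[ `<=` `]0, t[ by apply: subset_itvl; rewrite bnd_simp ltW.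
move=> /(bochner_restrict (measurable_itv _) mut (measurable_itv _) sub).
move=> /(bochner_add (measurable_itv _) mut hG); rewrite ez -linearD.
apply: bochner_ae_eq => //; apply: aeW => s /=; rewrite in_itv /= => hs.
have /andP[s0 st] := hs; rewrite mem_setE in_itv /= s0 /= (hf1 _ hs).
case: ifPn => [sc|_]; last by rewrite addr0.
rewrite linear0 add0r -(semigroupD hT) ?subr_ge0 ?ltW //; congr (T _ _).
by rewrite addrA subrK.
Qed.

Variables (p K : R).
Hypotheses (p1 : 1 < p) (K0 : 0 <= K).
Hypothesis hmax : forall f : R -> W,
  strongly_measurable `]0, +oo[ f -> (Lp_pow p f < +oo)%E ->
  exists g : R -> Z,
    [/\ {ae mu, forall t, 0 < t -> is_convolution T f t (k (g t))},
        strongly_measurable `]0, +oo[ g & (Lp_pow p g <= K%:E * Lp_pow p f)%E].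

(** On the fiber [q = n] the output is [G n t + z n (t - c n)]: maximal regularity produces [G n]
    from the restriction [f1 n], and [z n] is the orbit of [v n], the convolution at time [c n]. The
    index is countable, so the exceptional null sets can be united. [N] is a Borel version of the
    norm of [f]. *)
Lemma weighted_regularity (a : R) : a < 1 - p^-1 ->
  exists2 K' : R, 0 <= K' & forall (f : R -> W) (N : R -> R),
    strongly_measurable `]0, +oo[ f ->
    measurable_fun setT N -> (forall t, 0 <= N t) ->
    {ae mu, forall t, 0 < t -> rnorm (f t) = N t} ->
    (\int[mu]_(t in `]0%R, +oo[) (t `^ (a * p) * N t `^ p)%:E < +oo)%E ->
    exists g : R -> Z,
      [/\ {ae mu, forall t, 0 < t -> is_convolution T f t (k (g t))},
          strongly_measurable `]0, +oo[ g &
          (\int[mu]_(t in `]0%R, +oo[) (t `^ (a * p) * rnorm (g t) `^ p)%:E <=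
           K'%:E * \int[mu]_(t in `]0%R, +oo[) (t `^ (a * p) * N t `^ p)%:E)%E].
Proof.
move=> ap; have p0 : 0 < p by rewrite (lt_trans _ p1).
have [M M0 hM] := semigroup_bounded opA hk hT T_cts T_near0 T_A p0 K0 hmax.
have [L L0 hL] := semigroup_decay opA hk hT T_cts T_near0 T_A p0 K0 hmax.
have [Ch Ch0 hardyN] := hardy p1 ap.
have [q [q' [c [[mq mq'] c0 qc q'c qq']]]] := log_partition R.
pose kap : R := expR (2 * `|a * p|).
have kap0 : 0 <= kap by exact: expR_ge0.
(* [2 ^ p] bounds the power of a sum. Near part: one [kap] for each of two comparisons of weights,
   [K] from maximal regularity, 2 for the overlap of the sets [P n]. Far part: [L / (t - c)] is at
   most [2 * L / t], [M] bounds the semigroup inside [v n], and [Ch] is Hardy's constant. *)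
exists (2 `^ p * (kap * kap * K * 2 + (2 * L * M) `^ p * Ch)).
  by rewrite mulr_ge0 ?powR_ge0 // addr_ge0 // !mulr_ge0 ?powR_ge0.
move=> f N smf mN N0 fN J.
pose D : set R := [set` `]0, +oo[].
have mD : measurable D by exact: measurable_itv.
have Dgt0 t : D t <-> 0 < t by rewrite /D /= in_itv /= andbT.
pose Phi t := t `^ (a * p) * N t `^ p.
have Phi0 t : 0 <= Phi t by rewrite mulr_ge0 ?powR_ge0.
have mNp (g : R -> R) : measurable_fun setT g -> measurable_fun setT (fun t => g t `^ p).
  by move=> mg; exact: (measurableT_comp (measurable_powR p) mg).
have mPhi : measurable_fun setT Phi.
  by apply: measurable_funM; [exact: measurable_powR|exact: mNp].
have mE (g : R -> R) B : measurable_fun setT g -> measurable_fun B (EFin \o g).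
  by move=> mg; apply/measurable_EFinP; exact: measurable_funTS.
have H_fin := weight_locally_integrable p1 ap mN N0 J.
pose P n := q @^-1` [set n] `|` q' @^-1` [set n].
have mP n : measurable (P n) by exact: measurableU.
have Pc n t : D t -> P n t -> c n <= t <= expR 2 * c n.
  move=> /Dgt0 t0 [/= <-|/= <-]; last exact: q'c.
  have /andP[h ->] := qc t t0; rewrite andbT (le_trans _ h) //.
  by rewrite ler_peMl ?ler1n // ltW.
(* [f1 n] is the part of [f] near the diagonal for the outputs at [t] with
   [q t = n], and [v n] below collects the contribution of [(0, c n)]. *)
pose f1 n t := if t \in P n then f t else 0.
have smf1 n : strongly_measurable D (f1 n).
  apply: sm_if => //; last exact: sm_cst.
  by apply: sm_sub smf; exact: subIsetl.
(* On [P n] the weight is comparable to [c n ^ (a p)], which puts the restricted input in the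
   unweighted space. *)
have f1p n : (Lp_pow p (f1 n) <= (kap * c n `^ (- (a * p)))%:E *
    \int[mu]_(t in D `&` P n) (Phi t)%:E)%E.
  have kc0 : 0 <= kap * c n `^ (- (a * p)) by rewrite mulr_ge0 ?powR_ge0.
  rewrite -integral_EFinZl //; last exact: (measurableI _ _ mD (mP n)).
  rewrite integral_mkcondr /Lp_pow; apply: ae_le_lower_integral => [t _|t _|].
  - by rewrite lee_fin powR_ge0.
  - by rewrite /patch; case: ifP => // _; rewrite lee_fin mulr_ge0.
  apply: filterS fN => t h Dt; have t0 := (Dgt0 t).1 Dt; rewrite /patch /f1.
  case: ifPn => [/set_mem Pt|_]; last by rewrite rnorm0 powR0 ?gt_eqF.
  rewrite h // lee_fin.
  have [le1 _] := powR_ratio (- (a * p)) (c0 n) (Pc n t Dt Pt).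
  rewrite normrN -/kap in le1.
  have -> : N t `^ p = t `^ (- (a * p)) * Phi t.
    by rewrite /Phi mulrA -powRD ?(gt_eqF t0) ?implybT // addNr powRr0 mul1r.
  by rewrite ler_wpM2r.
have JP n : (\int[mu]_(t in D `&` P n) (Phi t)%:E < +oo)%E.
  apply: le_lt_trans J; apply: ge0_subset_integral => //.
  - exact: (measurableI _ _ mD (mP n)).
  - exact: mE.
  - by move=> t _; rewrite lee_fin Phi0.
have f1_fin n : (Lp_pow p (f1 n) < +oo)%E.
  apply: (le_lt_trans (f1p n)); rewrite lte_mul_pinfty ?lee_fin //.
  by rewrite mulr_ge0 ?powR_ge0.
have /choice [G hG] n := hmax (smf1 n) (f1_fin n).
have /choice [NG hNG] n : exists N : R -> R, [/\ measurable_fun setT N, forall t, 0 <= N t &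
    {ae mu, forall t, D t -> rnorm (G n t) = N t}].
  by apply: sm_norm; case: (hG n).
have cfin n : (mu `]0%R, (c n)[ < +oo)%E by exact: lebesgue_measure_oo_lty.
pose h n : R := fine (\int[mu]_(s in `]0%R, (c n)[) (N s)%:E)%E.
have hE n : ((h n)%:E = \int[mu]_(s in `]0%R, (c n)[) (N s)%:E)%E.
  rewrite /h fineK // ge0_fin_numE ?H_fin //.
  by apply: integral_ge0 => s _; rewrite lee_fin.
have h0 n : 0 <= h n.
  by rewrite -lee_fin hE; apply: integral_ge0 => s _; rewrite lee_fin.
have TN n : {ae mu, forall s, `]0, (c n)[%classic s -> rnorm (T (c n - s) (f s)) <= M * N s}.
  apply: filterS fN => s e; rewrite /= in_itv /= => /andP[s0 sc].
  by rewrite -e // hM // subr_ge0 ltW.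
have mMN : measurable_fun setT (fun s => M * N s) by exact: measurable_funM.
have MN0 s : 0 <= M * N s by rewrite mulr_ge0 // ltW.
have MNE n : (\int[mu]_(s in `]0%R, (c n)[) (M * N s)%:E = (M * h n)%:E)%E.
  by rewrite integral_EFinZl ?(ltW M0) // -hE EFinM.
(* The integral exists because [W] is complete and [N] is integrable on (0, c n). *)
have /choice [v hv] n : exists v,
    is_bochner_integral `]0, (c n)[ (fun s => T (c n - s) (f s)) v.
  apply: (bochner_exists _ _ _ mMN MN0 (TN n)) => //; last by rewrite MNE ltry.
  apply: (convolution_sm T_cts (ltW M0)) => //.
  apply: sm_sub smf => s; rewrite /= !in_itv /= => /andP[-> _] //.
have vh n : rnorm (v n) <= M * h n.
  rewrite -lee_fin -MNE; apply: (bochner_rnorm_le _ _ mMN MN0 (TN n) (hv n)) => //.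
have /choice [z hz] n : exists z : R -> Z, forall s, 0 < s ->
    T s (v n) = k (z s) /\ rnorm (z s) <= L / s * rnorm (v n).
  (* The choice is made for every real [s]; the value 0 at [s <= 0] is a placeholder. *)
  have /choice [z hz] s : exists z, 0 < s ->
      T s (v n) = k z /\ rnorm z <= L / s * rnorm (v n).
    have [s0|_] := ltP 0 s; last by exists 0.
    by have [z ? ?] := hL s (v n) s0; exists z.
  by exists z.
pose phi n t := Num.max (t - c n) 0.
have phiE t : 0 < t -> phi (q t) t = t - c (q t) /\ t / 2 <= t - c (q t).
  move=> t0; have /andP[h1 _] := qc t t0; have := c0 (q t).
  by move=> cq; split; [rewrite /phi max_l //; lra|lra].
exists (fun t => G (q t) t + z (q t) (phi (q t) t)); split.
- have : {ae mu, forall t n, 0 < t -> is_convolution T (f1 n) t (k (G n t))}.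
    by apply/ae_foralln => n; case: (hG n).
  apply: filterS => t /(_ (q t)) ht t0.
  have [-> tc] := phiE t t0.
  have tc0 : 0 < t - c (q t) by apply: lt_le_trans tc; rewrite divr_gt0.
  apply: (convolution_split (c0 (q t)) _ (hv (q t)) _ _ (ht t0)).
  + by rewrite -subr_gt0.
  + by have [] := hz (q t) _ tc0.
  (* [f1 n] may also keep values of [f] beyond [t], but the convolution at [t] only sees [s < t]. *)
  move=> s /andP[s0 st]; rewrite /f1; case: ifPn => [/set_mem Ps|/negP Ps].
    have /andP[h1 _] := Pc _ _ ((Dgt0 s).2 s0) Ps.
    by rewrite ltNge h1.
  case: ltP => // cs; case: Ps; apply/mem_set.
  by have [e|e] := qq' s t s0 st cs; [left|right].
- apply: (@sm_glue _ _ q D (fun n t => G n t + z n (phi n t))) => // n.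
  apply: sm_add; first by apply: sm_sub (subIsetl (B := _)) _; case: (hG n).
  apply: (orbit_graph_sm opA hk hT T_cts T_A (x := v n)) => //.
  + by apply: measurable_maxr => //; exact: measurable_funB.
  + by move=> t; rewrite /phi le_max lexx orbT.
  + move=> t [/Dgt0 t0 /= <-]; have [-> tc] := phiE t t0.
    by apply: lt_le_trans tc; rewrite divr_gt0.
  + by move=> s s0; have [] := hz n s s0.
pose Phi1 t := t `^ (a * p) * NG (q t) t `^ p.
pose Phi2 t := t `^ ((a - 1) * p) * h (q t) `^ p.
have NG0 n t : 0 <= NG n t by case: (hNG n).
have mNG n : measurable_fun setT (NG n) by case: (hNG n).
have mPhi1 : measurable_fun setT Phi1.
  apply: measurable_funM; first exact: measurable_powR.
  by apply: mNp; exact: measurable_glue.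
have mPhi2 : measurable_fun setT Phi2.
  apply: measurable_funM; first exact: measurable_powR.
  by apply: mNp; apply: (measurable_glue (g := fun n _ => h n)).
have Phi10 t : 0 <= Phi1 t by rewrite mulr_ge0 ?powR_ge0.
have Phi20 t : 0 <= Phi2 t by rewrite mulr_ge0 ?powR_ge0.
pose b := (2 * L * M) `^ p.
have b0 : 0 <= b by exact: powR_ge0.
have LM0 : 0 <= 2 * L * M by rewrite !mulr_ge0 // ltW.
(* The left integrand may fail to be Borel, so only monotonicity is used here; additivity comes in
   once [NG] and [h] have replaced the norms. *)
have step1 : (\int[mu]_(t in D) (t `^ (a * p) *
      rnorm (G (q t) t + z (q t) (phi (q t) t)) `^ p)%:E <=
    \int[mu]_(t in D) (2 `^ p * (Phi1 t + b * Phi2 t))%:E)%E.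
  apply: ae_le_lower_integral => [t _|t _|].
  - by rewrite lee_fin mulr_ge0 ?powR_ge0.
  - by rewrite lee_fin mulr_ge0 ?powR_ge0 // addr_ge0 // mulr_ge0.
  have : {ae mu, forall t n, D t -> rnorm (G n t) = NG n t}.
    by apply/ae_foralln => n; case: (hNG n).
  apply: filterS => t /(_ (q t)) ht Dt; have t0 := (Dgt0 t).1 Dt.
  have [-> tc] := phiE t t0.
  have t20 : 0 < t / 2 by rewrite divr_gt0.
  have tc0 : 0 < t - c (q t) by apply: lt_le_trans tc.
  have [_ zle] := hz (q t) _ tc0.
  have y0 : 0 <= 2 * L * M / t * h (q t) by rewrite mulr_ge0 // divr_ge0 // ltW.
  rewrite lee_fin.
  apply: (@le_trans _ _ (t `^ (a * p) *
      (2 `^ p * (NG (q t) t `^ p + (2 * L * M / t * h (q t)) `^ p)))).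
    rewrite ler_wpM2l ?powR_ge0 //.
    apply: (le_trans _ (powR_add_le (ltW p0) (NG0 _ _) y0)).
    apply: ge0_ler_powR; rewrite ?nnegrE ?rnorm_ge0 ?addr_ge0 ?(ltW p0) //.
    rewrite (le_trans (rnormD _ _)) // ht // lerD2l (le_trans zle) //.
    apply: (@le_trans _ _ (L / (t / 2) * (M * h (q t)))); last first.
      rewrite le_eqVlt; apply/orP; left; apply/eqP; field.
      by rewrite gt_eqF.
    apply: ler_pM; rewrite ?rnorm_ge0 ?divr_ge0 ?(ltW tc0) ?vh //.
    by rewrite ler_wpM2l // lef_pV2 ?posrE.
  rewrite mulrCA ler_wpM2l ?powR_ge0 // mulrDr lerD2l.
  rewrite powRM ?divr_ge0 ?(ltW t0) // powRM ?invr_ge0 ?(ltW t0) //.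
  rewrite /Phi2 /b le_eqVlt; apply/orP; left; apply/eqP.
  (* The factor [t^(- p)] from the decay estimate lowers the weight exponent to the one in Hardy's
     inequality. *)
  have -> : (a - 1) * p = a * p + - p by ring.
  rewrite powRD ?(gt_eqF t0) ?implybT //.
  by rewrite -powR_inv1 ?(ltW t0) // -powRrM mulN1r; ring.
have step2 : (\int[mu]_(t in D) (2 `^ p * (Phi1 t + b * Phi2 t))%:E =
    (2 `^ p)%:E * (\int[mu]_(t in D) (Phi1 t)%:E + b%:E * \int[mu]_(t in D) (Phi2 t)%:E))%E.
  have mbPhi2 : measurable_fun setT (fun t => b * Phi2 t) by exact: measurable_funM.
  have bPhi20 t : 0 <= b * Phi2 t by rewrite mulr_ge0.
  rewrite integral_EFinZl ?powR_ge0 //; last 2 first.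
  - exact: measurable_funD.
  - by move=> t; rewrite addr_ge0.
  congr (_ * _)%E; rewrite -integral_EFinZl //.
  under eq_integral do rewrite EFinD.
  by rewrite ge0_integralD //; [move=> t _; rewrite lee_fin|exact: mE|
    move=> t _; rewrite lee_fin|exact: mE].
have hPhi2 : (\int[mu]_(t in D) (Phi2 t)%:E <= Ch%:E * \int[mu]_(t in D) (Phi t)%:E)%E.
  apply: le_trans (hardyN N mN N0); apply: ae_le_lower_integral => [t _|t _|].
  - by rewrite lee_fin.
  - by rewrite mule_ge0 ?lee_fin ?powR_ge0 // poweR_ge0.
  apply: aeW => t /Dgt0 t0; rewrite EFinM; apply: lee_pmul; rewrite ?lee_fin ?powR_ge0 //.
  have H0 : (0 <= \int[mu]_(s in `]0%R, t[) (N s)%:E)%E.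
    by apply: integral_ge0 => s _; rewrite lee_fin.
  rewrite -poweR_EFin; apply: gt0_ler_poweR; rewrite ?(ltW p0) ?in_itv /= ?leey ?andbT ?lee_fin //.
  (* Since [c (q t) <= t], the integral up to [c (q t)] is at most the one up to [t]. *)
  rewrite hE; apply: ge0_subset_integral => //.
  - exact: mE.
  - by move=> s _; rewrite lee_fin.
  apply: subset_itvl; rewrite bnd_simp.
  have /andP[h1 _] := qc t t0; apply: le_trans h1.
  by rewrite ler_peMl ?ler1n // ltW.
have sumPhi (r : R -> nat) (Psi : R -> R) : (forall n, measurable (r @^-1` [set n])) ->
    measurable_fun setT Psi -> (forall t, 0 <= Psi t) ->
    (\int[mu]_(t in D) (Psi t)%:E =
     \sum_(n <oo) \int[mu]_(t in D `&` r @^-1` [set n]) (Psi t)%:E)%E.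
  move=> mr mPsi Psi0; apply: integral_fibers => //; first exact: mE.
  by move=> t _; rewrite lee_fin.
(* Every [t] lies in exactly one fiber of [q] and one of [q'], so summing over [n] counts the
   integral of [Phi] twice. *)
have PhiP n : (\int[mu]_(t in D `&` P n) (Phi t)%:E <=
    \int[mu]_(t in D `&` q @^-1` [set n]) (Phi t)%:E +
    \int[mu]_(t in D `&` q' @^-1` [set n]) (Phi t)%:E)%E.
  rewrite !integral_mkcondr -ge0_integralD //; last 4 first.
  - by move=> t _; rewrite /patch; case: ifP => // _; rewrite lee_fin.
  - by apply/(measurable_restrict _ (mq n) mD); exact: (mE Phi).
  - by move=> t _; rewrite /patch; case: ifP => // _; rewrite lee_fin.
  - by apply/(measurable_restrict _ (mq' n) mD); exact: (mE Phi).
  apply: ae_le_lower_integral => [t _|t _|].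
  - by rewrite /patch; case: ifP => // _; rewrite lee_fin.
  - by rewrite /patch adde_ge0 //; case: ifP => // _; rewrite lee_fin.
  apply: aeW => t _; rewrite /patch /P in_setU.
  case: (t \in q @^-1` [set n]); case: (t \in q' @^-1` [set n]) => //=;
    by rewrite ?adde0 ?add0e // leeDl ?lee_fin.
have hPhi1 : (\int[mu]_(t in D) (Phi1 t)%:E <=
    (kap * kap * K * 2)%:E * \int[mu]_(t in D) (Phi t)%:E)%E.
  have kK0 : 0 <= kap * kap * K by rewrite !mulr_ge0.
  have I0 B : (0 <= \int[mu]_(t in B) (Phi t)%:E)%E.
    by apply: integral_ge0 => t _; rewrite lee_fin.
  rewrite EFinM -muleA [(2%:E * _)%E]mule_natl mule2n.
  rewrite {1}(sumPhi q) // {1}(sumPhi q Phi) // (sumPhi q' Phi) //.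
  rewrite -nneseriesD // -nneseriesZl; last by move=> n _; rewrite adde_ge0.
  apply: lee_nneseries => [n _ _|n _].
    by apply: integral_ge0 => t _; rewrite lee_fin.
  apply: (@le_trans _ _ ((kap * c n `^ (a * p))%:E * Lp_pow p (G n))%E).
    have kc0 : 0 <= kap * c n `^ (a * p) by rewrite mulr_ge0 ?powR_ge0.
    have -> : Lp_pow p (G n) = (\int[mu]_(t in D) (NG n t `^ p)%:E)%E.
      apply: ae_eq_lower_integral => [t _|t _|]; rewrite ?lee_fin ?powR_ge0 //.
      by have [_ _ e] := hNG n; apply: filterS e => t + Dt => ->.
    rewrite -(integral_EFinZl mD (mNp _ (mNG n)) (fun=> powR_ge0 _ _) kc0).
    rewrite integral_mkcondr; apply: ae_le_lower_integral => [t _|t _|].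
    - by rewrite /patch; case: ifP => // _; rewrite lee_fin.
    - by rewrite lee_fin mulr_ge0 ?powR_ge0.
    apply: aeW => t Dt; rewrite /patch.
    case: ifPn => [/set_mem /= qt|_]; last by rewrite lee_fin mulr_ge0 ?powR_ge0.
    rewrite lee_fin /Phi1 qt ler_wpM2r ?powR_ge0 //.
    by have [] := powR_ratio (a * p) (c0 n) (Pc n t Dt (or_introl qt)).
  apply: (@le_trans _ _ ((kap * c n `^ (a * p))%:E * (K%:E *
      ((kap * c n `^ (- (a * p)))%:E * \int[mu]_(t in D `&` P n) (Phi t)%:E)))%E).
    apply: lee_wpmul2l; first by rewrite lee_fin mulr_ge0 ?powR_ge0.
    have [_ _ le1] := hG n; apply: (le_trans le1).
    by apply: lee_wpmul2l; rewrite ?lee_fin.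
  rewrite !muleA -!EFinM.
  (* The powers of [c n] from the input and the output cancel, leaving a constant independent of
     [n]. *)
  have -> : kap * c n `^ (a * p) * K * (kap * c n `^ (- (a * p))) = kap * kap * K.
    transitivity (kap * kap * K * (c n `^ (a * p) * c n `^ (- (a * p)))); first by ring.
    by rewrite -powRD ?(gt_eqF (c0 n)) ?implybT // subrr powRr0 mulr1.
  by apply: lee_wpmul2l; rewrite ?lee_fin.
apply: (le_trans step1); rewrite step2 EFinM -muleA.
apply: lee_wpmul2l; first by rewrite lee_fin powR_ge0.
have kK0 : (0 <= (kap * kap * K * 2)%:E)%E by rewrite lee_fin !mulr_ge0.
have bCh0 : (0 <= ((2 * L * M) `^ p * Ch)%:E)%E by rewrite lee_fin mulr_ge0.
rewrite EFinD (ge0_muleDl _ kK0 bCh0); apply: leeD; first exact: hPhi1.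
rewrite [((2 * L * M) `^ p * Ch)%:E]EFinM -muleA; apply: lee_wpmul2l.
  by rewrite lee_fin.
exact: hPhi2.
Qed.

End Weighted.

(** * Weighted norms and their behaviour under bounded operators *)

Section WeightedNorms.
Variable R : realType.
Notation mu := (@lebesgue_measure R).
Implicit Types E F : normedModType R[i].

Lemma Lp_pow_weight E (p a : R) (f : R -> E) :
  Lp_pow p (weight a f) =
  (\int[mu]_(t in `]0%R, +oo[) (t `^ (a * p) * rnorm (f t) `^ p)%:E)%E.
Proof.
apply: eq_integral => t _; congr (_%:E).
by rewrite /weight rnormZ ger0_norm ?powR_ge0 // powRM ?powR_ge0 ?rnorm_ge0 // -powRrM.
Qed.

Lemma sm_weight E (a : R) (D : set R) (f : R -> E) :
  strongly_measurable D f -> strongly_measurable D (weight a f).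
Proof. by apply: sm_scale => [|t]; [exact: measurable_powR|exact: powR_ge0]. Qed.

Lemma sm_unweight E (a : R) (f : R -> E) :
  strongly_measurable `]0, +oo[ (weight a f) -> strongly_measurable `]0, +oo[ f.
Proof.
move=> /(sm_weight (- a)); apply: sm_ae_eq; apply: aeW => t.
rewrite /= in_itv /= andbT => t0; rewrite /weight scalerA -rmorphM /=.
by rewrite -powRD ?(gt_eqF t0) ?implybT // addNr powRr0 scale1r.
Qed.

Lemma weighted_linear_le E F (S : {linear E -> F}) (p a M : R) (f : R -> E) :
  0 < p -> 0 <= M -> (forall x, rnorm (S x) <= M * rnorm x) ->
  strongly_measurable `]0, +oo[ f ->
  (Lp_pow p (weight a (S \o f)) <= (M `^ p)%:E * Lp_pow p (weight a f))%E.
Proof.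
move=> p0 M0 SM /sm_norm [N [mN N0 fN]]; rewrite !Lp_pow_weight.
have -> : (\int[mu]_(t in `]0%R, +oo[) (t `^ (a * p) * rnorm (f t) `^ p)%:E =
    \int[mu]_(t in `]0%R, +oo[) (t `^ (a * p) * N t `^ p)%:E)%E.
  apply: ae_eq_lower_integral => [t _|t _|]; rewrite ?lee_fin ?mulr_ge0 ?powR_ge0 //.
  by apply: filterS fN => t + Dt => ->.
rewrite -integral_EFinZl ?powR_ge0 //; last 2 first.
- apply: measurable_funM; first exact: measurable_powR.
  exact: (measurableT_comp (measurable_powR p) mN).
- by move=> t; rewrite mulr_ge0 ?powR_ge0.
apply: ae_le_lower_integral => [t _|t _|]; rewrite ?lee_fin ?mulr_ge0 ?powR_ge0 //.
apply: filterS fN => t + Dt => /(_ Dt) <-.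
rewrite lee_fin mulrCA ler_wpM2l ?powR_ge0 // -powRM ?rnorm_ge0 //.
by apply: ge0_ler_powR; rewrite ?nnegrE ?mulr_ge0 ?rnorm_ge0 ?(ltW p0) // SM.
Qed.

End WeightedNorms.

(** By the semigroup law [T t] commutes with the difference quotients, and it is continuous. *)
Lemma generator_semigroup (R : realType) (E : normedModType R[i])
    (T : R -> {linear E -> E}) (t : R) (x y : E) : semigroup T -> 0 <= t ->
  generator T (x, y) -> generator T (T t x, T t y).
Proof.
move=> [cT _ TD] t0; rewrite /generator /= => h.
apply: (cvg_trans _ (continuous_cvg _ (cT t t0 y) h)); apply: near_eq_cvg.
near=> s; have s0 : 0 <= s by near: s; exact: nbhs_right_ge.
by rewrite /= linearZ linearB /= -!TD // (addrC t).
Unshelve. all: by end_near. Qed.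

Theorem theorem1p15 (R : realType)
  (X U Y Xm1 W : completeNormedModType R[i]) (Z : normedModType R[i])
  (omega : R) (A : set (X * X)) (T : R -> {linear X -> X})
  (hA : sectorial omega A) (homega : omega < pi / 2)
  (hAdom : dense (op_dom A)) (hArange : dense (op_range A))
  (hT : C0_semigroup T) (hTA : generator T = op_opp A)
  (iota : {linear X -> Xm1}) (hiota : is_extrapolation A iota)
  (Tm1 : R -> {linear Xm1 -> Xm1}) (hTm1 : C0_semigroup Tm1)
  (hTTm1 : forall t x, 0 <= t -> Tm1 t (iota x) = iota (T t x))
  (Am1 : set (Xm1 * Xm1)) (hAm1 : generator Tm1 = op_opp Am1)
  (i : {linear X -> W}) (hi : is_embedding i)
  (j : {linear W -> Xm1}) (hj : is_embedding j)
  (hij : forall x, j (i x) = iota x)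
  (omegaW : R) (hAW : sectorial omegaW (op_part j Am1))
  (TW : R -> {linear W -> W})
  (hTW : forall t w, 0 <= t -> j (TW t w) = Tm1 t (j w))
  (hTWA : generates (op_opp (op_part j Am1)) TW)
  (k : {linear Z -> W}) (hk : is_graph_domain (op_part j Am1) k)
  (p p' : R) (hp : 1 < p) (hpp' : p^-1 + p'^-1 = 1)
  (hmax : maximal_Lp_regularity k TW p)
  (C : {linear Z -> Y}) (hC : continuous C)
  (B : {linear U -> W}) (hB : continuous B)
  (alpha : R) (halpha : - p^-1 < alpha < p'^-1) :
  input_output_bounded k TW B C p alpha.
Proof.
have p0 : 0 < p by exact: lt_trans hp.
have [_ opA _ _ _] := hAW.
have [hTWs TW_cts TW_near0 _] := hTWA.
(* Invariance is checked in [Xm1], where [Am1] is the generator up to sign: [generator TW] may be a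
   proper part of the operator that generates [TW] in the sense of [generates]. *)
have TW_A t x y : 0 <= t -> op_part j Am1 (x, y) -> op_part j Am1 (TW t x, TW t y).
  move=> t0; rewrite /op_part /= !hTW //.
  have AE u v : Am1 (u, v) = generator Tm1 (u, - v).
    by rewrite hAm1 /op_opp /= opprK.
  by rewrite !AE -[- Tm1 t (j y)]linearN; apply: generator_semigroup => //; case: hTm1.
have [K K0 hK] := maximal_regularity_pow p0 hmax.
have halpha' : alpha < 1 - p^-1.
  by have /andP[_] := halpha; rewrite -hpp' (addrC p^-1) addrK.
have [K' K'0 hK'] :=
  weighted_regularity opA hk hTWs TW_cts TW_near0 TW_A hp K0 hK halpha'.
have [MB [MB0 hMB]] := linear_rnorm_le hB.
have [MC [MC0 hMC]] := linear_rnorm_le hC.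
(* [Q] is a constant for p-th powers, with one factor for each of [C], the convolution and [B]; its
   p-th root bounds the norms. *)
pose Q := MC `^ p * K' * MB `^ p.
have Q0 : 0 <= Q by rewrite !mulr_ge0 ?powR_ge0.
exists (Q `^ p^-1) => u [smu]; rewrite /Lpw_norm.
rewrite Lp_norm_lty ?gt_eqF // => up.
have {}smu := sm_unweight smu.
have smf : strongly_measurable `]0, +oo[ (B \o u) by exact: sm_linear.
have [N [mN N0 fN]] := sm_norm smf.
have fN' : {ae lebesgue_measure, forall t : R, 0 < t -> rnorm ((B \o u) t) = N t}.
  by apply: filterS fN => t + t0; apply; rewrite /= in_itv /= t0.
have NE : Lp_pow p (weight alpha (B \o u)) =
    (\int[lebesgue_measure]_(t in `]0%R, +oo[) (t `^ (alpha * p) * N t `^ p)%:E)%E.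
  rewrite Lp_pow_weight.
  apply: ae_eq_lower_integral => [t _|t _|]; rewrite ?lee_fin ?mulr_ge0 ?powR_ge0 //.
  by apply: filterS fN => t + Dt => ->.
have fle := weighted_linear_le alpha p0 MB0 hMB smu.
have [|g [gconv smg gle]] := hK' _ N smf mN N0 fN'.
  rewrite -NE; apply: (le_lt_trans fle).
  by rewrite lte_mul_pinfty ?lee_fin ?powR_ge0.
exists g.
have Cle : (Lp_pow p (weight alpha (C \o g)) <= Q%:E * Lp_pow p (weight alpha u))%E.
  apply: (le_trans (weighted_linear_le alpha p0 MC0 hMC smg)).
  rewrite /Q -mulrA EFinM -muleA; apply: lee_wpmul2l; first by rewrite lee_fin powR_ge0.
  rewrite Lp_pow_weight; apply: (le_trans gle).
  rewrite EFinM -muleA; apply: lee_wpmul2l; first by rewrite lee_fin.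
  by rewrite -NE.
split=> //.
- split; first by apply: sm_weight; exact: sm_linear.
  apply/Lp_norm_lty; first by rewrite gt_eqF.
  by apply: (le_lt_trans Cle); rewrite lte_mul_pinfty ?lee_fin.
- apply/Lp_norm_le => //; first exact: powR_ge0.
  by rewrite -powRrM mulVf ?gt_eqF // powRr1.
Qed.
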